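(* Let $N\geq 4$ be an integer, let $G,m,h>0$ be constants, let $E\in\mathbb{R}$, $I>0$, $U>0$, and let $\epsilon$ satisfy $1>\epsilon>\frac{2}{N}$. Let $|\Gamma(E,I\pm\epsilon I,U\pm\epsilon U)|$ denote the phase space volume (defined in the context) of the macro-region of the Newtonian gravitational $N$-particle system with energy $E$, moment of inertia in $[(1-\epsilon)I,(1+\epsilon)I]$ and absolute value of the potential energy in $[(1-\epsilon)U,(1+\epsilon)U]$. Let $\Omega^{3N-1}$ denote the surface area of the $(3N-1)$-dimensional unit sphere and set $$C=\frac{(2m)^{\frac{3N-2}{2}}}{2\,(N!)\,h^{3N}}\left(\Omega^{3N-1}\right)^2 .$$ If the scale-invariant quantity $\sqrt{I}\,U$ is large enough that $$\sqrt{I}\,U\;\geq\;4\,G\,m^{5/2}\,\log(N)\,N^{5/2},$$ then $$|\Gamma(E,I\pm\epsilon I,U\pm\epsilon U)|\;\geq\; C\,e^{-\frac{9}{2}N}\left(\frac{Gm^2\epsilon}{U}\right)^3\bigl(E+(1-\epsilon)U\bigr)^{\frac{3N-2}{2}}\left(\frac{I}{m}\right)^{\frac{3N-3}{2}}$$ and $$|\Gamma(E,I\pm\epsilon I,U\pm\epsilon U)|\;\leq\; C\,\bigl(E+(1+\epsilon)U\bigr)^{\frac{3N-2}{2}}\left((1+\epsilon)\frac{I}{m}\right)^{\frac{3N}{2}} .$$ For non-negative $E$, these bounds can be simplified further using $$(E+(1+\epsilon)U)^n\leq(1+\epsilon)^n(E+U)^n\leq e^{\epsilon n}(E+U)^n,$$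 respectively $$(E+(1-\epsilon)U)^n\geq(1-\epsilon)^n(E+U)^n\geq e^{-2\epsilon n}(E+U)^n,$$ for $\epsilon<\frac12$ (applied with exponent $n=\frac{3N-2}{2}$).
   Context: Consider $N$ point particles of equal mass $m$ with positions $q=(\mathbf{q}_1,\dots,\mathbf{q}_N)\in\mathbb{R}^{3N}$ and momenta $p=(\mathbf{p}_1,\dots,\mathbf{p}_N)\in\mathbb{R}^{3N}$, in the center-of-mass frame, and the Hamiltonian $$H(q,p)=\sum_{i=1}^N\frac{\mathbf{p}_i^2}{2m}-\sum_{1\leq i<j\leq N}\frac{Gm^2}{|\mathbf{q}_i-\mathbf{q}_j|},$$ where $G$ is the gravitational constant and $h$ is the constant normalizing phase space volume. The phase space volume of the macro-region is $$|\Gamma(E,I\pm\epsilon I,U\pm\epsilon U)|=\frac{1}{N!\,h^{3N}}\int\mathrm{d}^{3N}p\int\mathrm{d}^{3N}q\;\delta\bigl(H(q,p)-E\bigr)\,\mathbf{1}\Bigl\{(1-\epsilon)U\leq\sum_{1\le i<j\le N}\tfrac{Gm^2}{|\mathbf{q}_i-\mathbf{q}_j|}\leq(1+\epsilon)U\Bigr\}\,\mathbf{1}\Bigl\{(1-\epsilon)I\leq\sum_{i=1}^N m\,\mathbf{q}_i^2\leq(1+\epsilon)I\Bigr\},$$ where the integrals are over $\mathbb{R}^{3N}$, $\delta$ is the Dirac delta and $\mathbf{1}\{\cdot\}$ is the indicator function. (Strictly, one starts with $\sum_{i} m(\mathbf{q}_i-\frac1N\sum_j\mathbf{q}_j)^2$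 in place of $\sum_i m\mathbf{q}_i^2$ and the additional constraint $\sum_j\mathbf{q}_j\equiv 0$ fixing the center of mass at the origin; the volume bounded is the integral as displayed.) Here $\log$ is the natural logarithm, and $\Omega^{3N-1}=2\pi^{3N/2}/\Gamma_{\mathrm{Euler}}(3N/2)$, with $\Gamma_{\mathrm{Euler}}$ Euler's gamma function.
   Formalization: In C the power of 2m is 3N/2 instead of (3N-2)/2: the printed C misses the Jacobian 2m of p^2/(2m), and rescaling m, G, I with Gm^2 and I/m fixed refutes both printed bounds. Powers of a negative E+(1-ε)U or E+(1+ε)U are read as 0. *)

(* Defs.v *)
From HB Require Import structures.
From mathcomp Require Import all_boot all_order all_algebra.
From mathcomp Require Import all_classical all_reals all_analysis.

Set Implicit Arguments.
Unset Strict Implicit.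
Unset Printing Implicit Defensive.

Import Order.TTheory GRing.Theory Num.Theory.
Import numFieldTopology.Exports numFieldNormedType.Exports.

Local Open Scope classical_set_scope.
Local Open Scope ring_scope.

(** Powers [mu ^ n] of a sigma-finite measure, as a measure on [n.-tuple T]
    with the product sigma-algebra:
    [mu ^ 0] is the Dirac mass at the empty tuple, and [mu ^ (n + 1)] is the
    image of the product measure [mu \x mu ^ n] under [(x, t) |-> x :: t]. *)
Section TupleMeasure.
Context d (T : measurableType d) (R : realType).
Implicit Types (n : nat).

Definition tcons n (x : T * n.-tuple T) : n.+1.-tuple T :=
  [the n.+1.-tuple T of x.1 :: x.2].

Definition tuncons n (t : n.+1.-tuple T) : T * n.-tuple T :=
  (thead t, [tuple of behead t]).

Lemma tconsK n : cancel (@tcons n) (@tuncons n).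
Proof. by case=> x t; congr (_, _); exact/val_inj. Qed.

Lemma tunconsK n : cancel (@tuncons n) (@tcons n).
Proof. by move=> t; rewrite [RHS]tuple_eta; apply/val_inj. Qed.

Lemma measurable_tcons n : measurable_fun [set: T * n.-tuple T] (@tcons n).
Proof. by apply: measurable_cons. Qed.

Lemma measurable_tuncons n :
  measurable_fun [set: n.+1.-tuple T] (@tuncons n).
Proof.
apply: (@measurable_fun_pair _ _ _ _ _ _ (fun t : n.+1.-tuple T => thead t)
  (fun t => [tuple of behead t])) => //.
- exact: measurable_tnth.
- exact: measurable_behead.
Qed.

Definition tuple_measureS n (mu : {sigma_finite_measure set T -> \bar R})
    (nu : {sigma_finite_measure set (n.-tuple T) -> \bar R}) :
    set (n.+1.-tuple T) -> \bar R :=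
  pushforward (mu \x nu)%E (@tcons n).

HB.instance Definition _ n mu nu := Measure.copy (@tuple_measureS n mu nu)
  (measure_function_pushforward__canonical__measure_function_Measure
     (mu \x nu)%E (@measurable_tcons n)).

Lemma tuple_measureS_sigma_finite n mu nu :
  sigma_finite setT (@tuple_measureS n mu nu).
Proof.
have [F TF Foo] := sigma_finiteT mu.
have [G TG Goo] := sigma_finiteT nu.
exists (fun k => if unpickle k isn't Some (i, j) then set0
                 else @tuncons n @^-1` (F i `*` G j)).
  apply/esym/seteqP; split => // t _.
  have [i _ Fi] : (\bigcup_i F i) (tuncons t).1 by rewrite -TF.
  have [j _ Gj] : (\bigcup_j G j) (tuncons t).2 by rewrite -TG.
  by exists (pickle (i, j)); rewrite // pickleK.
move=> k; case: unpickle => [[i j]|]; last by rewrite measure0.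
have [mFi Fioo] := Foo i; have [mGj Gjoo] := Goo j.
split.
  rewrite -[X in measurable X]setTI; apply: measurable_tuncons => //.
  exact: measurableX.
rewrite /= /tuple_measureS /pushforward -comp_preimage.
rewrite (_ : _ \o _ = id); last exact/funext/tconsK.
by rewrite preimage_id product_measure1E// lte_mul_pinfty// ge0_fin_numE.
Qed.

HB.instance Definition _ n mu nu := Measure_isSigmaFinite.Build _ _ _
  (@tuple_measureS n mu nu) (@tuple_measureS_sigma_finite n mu nu).

Fixpoint tuple_measure (mu : {sigma_finite_measure set T -> \bar R}) n :
    {sigma_finite_measure set (n.-tuple T) -> \bar R} :=
  if n isn't n'.+1 then \d_([tuple] : 0.-tuple T)
  else tuple_measureS mu (tuple_measure mu n').

End TupleMeasure.

Section Gravity.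
Context {R : realType}.

Definition space : Type := 3.-tuple (measurableTypeR R).

Definition lebesgue3 :
    {sigma_finite_measure set (3.-tuple (measurableTypeR R)) -> \bar R} :=
  tuple_measure (@lebesgue_measure R) 3.

(* Lebesgue measure on R^{3N} = (R^3)^N *)
Definition lebesgue3N N :
    {sigma_finite_measure set (N.-tuple (3.-tuple (measurableTypeR R)))
       -> \bar R} :=
  tuple_measure lebesgue3 N.

Definition normsq (x : space) : R := \sum_(k < 3) (tnth x k : R) ^+ 2.

Definition dist (x y : space) : R :=
  Num.sqrt (\sum_(k < 3) ((tnth x k : R) - tnth y k) ^+ 2).

Section System.
Variables (N : nat) (G m : R).
Implicit Types (q p : N.-tuple space).

(* Absolute value of the potential energy. On the Lebesgue-null set of
   configurations with a coincidence, a pair at distance 0 contributes 0. *)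
Definition abs_potential q : R :=
  \sum_(i < N) \sum_(j < N | (i < j)%N)
    G * m ^+ 2 / dist (tnth q i) (tnth q j).

Definition kinetic p : R := \sum_(i < N) normsq (tnth p i) / (2 * m).

Definition hamiltonian q p : R := kinetic p - abs_potential q.

Definition inertia q : R := \sum_(i < N) m * normsq (tnth q i).

End System.

(* Approximation of the Dirac delta by the uniform density on [-eta, eta]. *)
Definition delta_approx (eta x : R) : R := (2 * eta)^-1 * \1_[set y | `|y| <= eta] x.

Section PhaseVolume.
Variables (N : nat) (G m h E I U eps : R).

(* The phase space integral with delta(H - E) replaced by
   [delta_approx eta (H - E)]. *)
Definition shell_volume (eta : R) : \bar R :=
  ((N`!%:R * h ^+ (3 * N))^-1%:E *
   \int[lebesgue3N N]_p \int[lebesgue3N N]_q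
     (delta_approx eta (hamiltonian G m q p - E) *
      \1_[set q | (1 - eps) * U <= abs_potential G m q <= (1 + eps) * U] q *
      \1_[set q | (1 - eps) * I <= inertia m q <= (1 + eps) * I] q)%:E)%E.

(* |Gamma(E, I +- eps I, U +- eps U)|: the integral against delta(H - E) is the
   limit eta -> 0+ of the integrals against [delta_approx eta (H - E)]. As [lim]
   is total, its existence is to be stated separately. *)
Definition phase_volume : \bar R := lim (shell_volume eta @[eta --> 0^'+]).

End PhaseVolume.

Definition euler_gamma (s : R) : R :=
  \int[lebesgue_measure]_(t in `]0, +oo[) (t `^ (s - 1) * expR (- t)).

(* Area of the unit sphere of R^{3N}. *)
Definition sphere_area (N : nat) : R :=
  2 * pi `^ (3 * N%:R / 2) / euler_gamma (3 * N%:R / 2).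

(* The power of 2m is that of the momentum integral, for K > 0,
     \int_{R^{3N}} delta(p^2 / (2m) - K) dp
       = (2m)^{3N/2} / 2 * sphere_area N * K^{(3N-2)/2}.
   An exponent (3N-2)/2 of 2m would omit the Jacobian 2m of p^2 |-> p^2 / (2m):
   under m -> s m, G -> G / s^2, I -> s I (h, E, U, eps fixed) the volume scales
   as s^{3N/2}, and all else in the bounds but the power of m in C is
   invariant. *)
Definition prefactor (N : nat) (m h : R) : R :=
  (2 * m) `^ (3 * N%:R / 2) / (2 * N`!%:R * h ^+ (3 * N)) * sphere_area N ^+ 2.

(* Real power of the positive part: [x `^ a] of the library is 1 for x < 0.
   No configuration has kinetic energy E + |potential| < 0, so the powers of
   E + (1 -+ eps) U in the bounds are to be read as 0 when the base is
   negative. *)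
Definition pos_powR (x a : R) : R := Num.max x 0 `^ a.

End Gravity.

(* Main.v *)
Require Import Defs.
From HB Require Import structures.
From mathcomp Require Import all_boot all_order all_algebra.
From mathcomp Require Import all_classical all_reals all_analysis.
From mathcomp Require Import measurable_realfun ring lra.

(** The tolerance [eps > 2 / N] of the moment of inertia is spent twice: from below it pays for the
    thickness [1 / N] of the shell of the first [N - 1] particles, from above for the share of the
    last particle, about [1 / (N - 1)] of the total. The obstacle is that a cube or a ball gives no
    lower control of the radius. The condition [V <= v] is therefore weakened to the scale-invariant
    [V ^+ 2 * normsqN q <= v ^+ 2 * t], which cuts out a cone; the inner ball of squared radius
    [(1 - 1 / N) * t] holds at most half of the cone's volume, so half of it lies in the shell.

    The factor 4 in the hypothesis on [Num.sqrt I * U] is a budget: in units of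
    [(N - 1) ^ 2 * g / rho] with [g = G * m ^+ 2], the shell costs 35/12 and the starting point of
    the last particle costs 1, in total 47/12. The factor [e^(-9N/2)] is e^(-3/2) per coordinate;
    together with the decay of the sphere area it beats [(N - 1) ^ (3 (N - 1) / 2)], which appears
    when [rho] is expressed by [I].

    Of the two sphere areas in the prefactor, one belongs to the momenta and one to the
    positions. *)

(** Integrating the momenta first turns the smoothed delta function into the
    difference quotient of the volume of a ball of R^{3N}, a multiple of
    K_+^{3N/2} with K = E + V(q); the quotients converge uniformly on the
    macro-region, so the phase volume is a constant times the integral of
    K_+^{(3N-2)/2} over it. The constant is found from the Gaussian integral. Both
    bounds thus reduce to bounds on the configuration volume of the macro-region.
    It lies in the ball |q|^2 <= (1 + eps) I / m, which gives the upper bound.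

    For the lower bound, let rho^2 = I / (m (N-1)). A Markov inequality on a cube,
    together with homogeneity of V, yields many configurations of N - 1 particles
    in a thin shell |q'|^2 ~ (N-1) rho^2 whose potential is well below U. Given
    one, the last particle starts from a point far from all others and moves
    towards a particle at distance at most rho from the origin. By the
    intermediate value theorem it meets a point where the total potential is
    exactly U; all distances are then at least G m^2 / U, so the potential stays
    within the relative error eps when the particle moves by less than
    eps G m^2 / (2 U). This is the origin of the factor (G m^2 eps / U)^3. *)

Set Implicit Arguments.
Unset Strict Implicit.
Unset Printing Implicit Defensive.

Import Order.TTheory GRing.Theory Num.Theory.
Import numFieldTopology.Exports numFieldNormedType.Exports.

Local Open Scope classical_set_scope.
Local Open Scope ring_scope.

(** * Integration on tuples *)

Section TupleIntegral.
Context d (T : measurableType d) (R : realType).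
Variable mu : {sigma_finite_measure set T -> \bar R}.
Local Open Scope ereal_scope.

Lemma measurable_map_tuple n (phi : T -> T) : measurable_fun [set: T] phi ->
  measurable_fun [set: n.-tuple T] (fun t => [tuple of map phi t]).
Proof.
move=> mphi; apply/measurable_fun_tnthP => i.
rewrite (_ : _ \o _ = phi \o (@tnth _ T ^~ i)); last first.
  by apply/funext => t /=; rewrite tnth_map.
by apply: measurableT_comp => //; exact: measurable_tnth.
Qed.

Lemma integral_tuple0 (f : 0.-tuple T -> \bar R) :
  \int[tuple_measure mu 0]_t f t = f [tuple].
Proof.
rewrite /= integral_dirac//; first by rewrite diracT mul1e.
rewrite (_ : f = cst (f [tuple])); first exact: measurable_cst.
by apply/funext => t; rewrite (tuple0 t).
Qed.

Section Succ.
Variables (n : nat) (f : n.+1.-tuple T -> \bar R).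
Hypothesis mf : measurable_fun [set: n.+1.-tuple T] f.
Hypothesis f0 : forall t, 0 <= f t.

Lemma integral_tupleSE : \int[tuple_measure mu n.+1]_t f t =
  \int[mu \x tuple_measure mu n]_z f (tcons z).
Proof.
rewrite /= /tuple_measureS (@ge0_integral_pushforward _ _ _ _ _ (@tcons _ T n)) //.
exact: measurable_tcons.
Qed.

Lemma measurable_comp_tcons :
  measurable_fun [set: T * n.-tuple T] (fun z => f (tcons z)).
Proof. by apply: measurableT_comp => //; exact: measurable_tcons. Qed.

Lemma integral_tupleS : \int[tuple_measure mu n.+1]_t f t =
  \int[mu]_x \int[tuple_measure mu n]_t f (tcons (x, t)).
Proof.
by rewrite integral_tupleSE (fubini_tonelli1 (fun z => f (tcons z)))//;
  exact: measurable_comp_tcons.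
Qed.

Lemma integral_tupleSr : \int[tuple_measure mu n.+1]_t f t =
  \int[tuple_measure mu n]_t \int[mu]_x f (tcons (x, t)).
Proof.
by rewrite integral_tupleSE (fubini_tonelli2 (fun z => f (tcons z)))//;
  exact: measurable_comp_tcons.
Qed.

Lemma measurable_integral_tcons : measurable_fun [set: T]
  (fun x => \int[tuple_measure mu n]_t f (tcons (x, t))).
Proof.
exact: (measurable_fun_fubini_tonelli_F (m2 := tuple_measure mu n)
  (fun z => f (tcons z)) measurable_comp_tcons (fun z => f0 _)).
Qed.

Lemma measurable_integral_tconsr : measurable_fun [set: n.-tuple T]
  (fun t => \int[mu]_x f (tcons (x, t))).
Proof.
exact: (measurable_fun_fubini_tonelli_G (m1 := mu)
  (fun z => f (tcons z)) measurable_comp_tcons (fun z => f0 _)).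
Qed.

End Succ.

(** Abstract in [phi] because it is applied twice: to the three coordinates of a particle and then
    to the [N] particles. *)
Lemma ge0_integral_map_tuple (phi : T -> T) (k : R) n (f : n.-tuple T -> \bar R) :
  (0 <= k)%R -> measurable_fun [set: T] phi ->
  (forall g : T -> \bar R, measurable_fun [set: T] g -> (forall x, 0 <= g x) ->
    \int[mu]_x g (phi x) = k%:E * \int[mu]_x g x) ->
  measurable_fun [set: n.-tuple T] f -> (forall t, 0 <= f t) ->
  \int[tuple_measure mu n]_t f [tuple of map phi t] =
  (k ^+ n)%:E * \int[tuple_measure mu n]_t f t.
Proof.
move=> k0 mphi phiE; elim: n f => [|n ih] f mf f0.
  rewrite !integral_tuple0 expr0 mul1e; congr (f _); exact/val_inj.
rewrite !integral_tupleS//; last first.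
  by apply: measurableT_comp => //; exact: measurable_map_tuple.
under eq_integral.
  move=> x _.
  have E t : f [tuple of map phi (tcons (x, t))] =
             f (tcons (phi x, [tuple of map phi t])).
    by congr (f _); exact/val_inj.
  under eq_integral do rewrite E.
  rewrite (ih (fun t => f (tcons (phi x, t)))) //; last first.
    exact: (measurableT_comp (measurable_comp_tcons mf)
      (measurable_fun_pair (measurable_cst (phi x)) (@measurable_id _ _ setT))).
  over.
rewrite ge0_integralZl//; last 3 first.
- exact: (measurableT_comp (measurable_integral_tcons mf f0) mphi).
- by move=> x _; apply: integral_ge0.
- by rewrite lee_fin exprn_ge0.
rewrite (phiE (fun x => \int[tuple_measure mu n]_t f (tcons (x, t)))).
- by rewrite muleA -EFinM exprSr.
- exact: measurable_integral_tcons.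
- by move=> x; apply: integral_ge0.
Qed.

(** Tonelli, one coordinate at a time. Indicators as factors give the volume of boxes, Gaussians as
    factors give the volume of balls. *)
Lemma integral_tuple_prod n (f : 'I_n -> T -> R) (r : 'I_n -> R) :
  (forall i, measurable_fun [set: T] (f i)) -> (forall i x, (0 <= f i x)%R) ->
  (forall i, \int[mu]_x (f i x)%:E = (r i)%:E) ->
  \int[tuple_measure mu n]_t (\prod_(i < n) f i (tnth t i))%:E
  = (\prod_(i < n) r i)%:E.
Proof.
elim: n f r => [|n ih] f r mf f0 fr.
  by rewrite integral_tuple0 !big_ord0.
rewrite integral_tupleS; last 2 first.
- apply/measurable_EFinP; apply: measurable_prod => i _.
  by apply: measurableT_comp => //; exact: measurable_tnth.
- by move=> t; rewrite lee_fin prodr_ge0.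
have E x (t : n.-tuple T) : (\prod_(i < n.+1) f i (tnth (tcons (x, t)) i))%:E =
    (f ord0 x)%:E * (\prod_(i < n) f (lift ord0 i) (tnth t i))%:E.
  rewrite -EFinM big_ord_recl; congr ((_ * _)%:E)%R.
  by apply: eq_bigr => i _; rewrite tnthS.
under eq_integral.
  move=> x _; under eq_integral do rewrite E.
  rewrite ge0_integralZl//; last 3 first.
  - apply/measurable_EFinP; apply: measurable_prod => i _.
    by apply: measurableT_comp => //; exact: measurable_tnth.
  - by move=> t _; rewrite lee_fin prodr_ge0.
  - by rewrite lee_fin.
  rewrite (ih (fun i => f (lift ord0 i)) (fun i => r (lift ord0 i)))//.
  over.
have r0 i : (0 <= r i)%R.
  by rewrite -lee_fin -fr integral_ge0// => x _; rewrite lee_fin.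
rewrite ge0_integralZr//.
- by rewrite fr -EFinM big_ord_recl.
- exact/measurable_EFinP.
- by move=> x _; rewrite lee_fin.
- by rewrite lee_fin prodr_ge0.
Qed.

Lemma tuple_measure_box n (A : 'I_n -> set T) (r : 'I_n -> R) :
  (forall i, measurable (A i)) -> (forall i, mu (A i) = (r i)%:E) ->
  tuple_measure mu n [set t | forall i, A i (tnth t i)] = (\prod_(i < n) r i)%:E.
Proof.
move=> mA Ar.
set S := [set t : n.-tuple T | _].
have mS : measurable S.
  rewrite (_ : S =
      \bigcap_(i in [set: 'I_n]) ((@tnth _ T ^~ i) @^-1` A i)); last first.
    by apply/seteqP; split => t /= h; [move=> i _; exact: h|move=> i; exact: h].
  apply: fin_bigcap_measurable => //.
  move=> i _; rewrite -[X in measurable X]setTI.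
  exact: measurable_tnth.
rewrite -[S in LHS]setIT -integral_indic//.
have iA i : \int[mu]_x (\1_(A i) x : R)%:E = (r i)%:E.
  by rewrite integral_indic// setIT; exact: Ar.
have mI i : measurable_fun [set: T] (\1_(A i) : T -> R) by exact: measurable_indic.
have I0 i x : (0 <= \1_(A i) x :> R)%R by rewrite indicE.
rewrite -(integral_tuple_prod mI I0 iA).
apply: eq_integral => t _; congr EFin.
rewrite indicE; have [tA|tA] := boolP (t \in S).
  rewrite big1// => i _; rewrite indicE mem_set//.
  by move: tA; rewrite inE; apply.
have /existsNP[i Ai] : ~ forall i, A i (tnth t i).
  by move=> h; move/negP: tA; apply; rewrite inE.
by rewrite (bigD1 i)//= indicE memNset// mul0r.
Qed.

End TupleIntegral.

(** * Lebesgue measure on R^{3N} *)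

Section LineScaling.
Context {R : realType}.
Local Notation mu := (@lebesgue_measure R).
Local Notation RR := (measurableTypeR R).

Definition mull (a : R) : RR -> RR := fun u => a * u.

Lemma measurable_mull (a : R) : measurable_fun [set: RR] (mull a).
Proof. by apply: measurable_funM => //; exact: measurable_id. Qed.

Lemma preimage_mull_itvoc (k a b : R) : 0 < k ->
  mull k @^-1` `]a, b] = `](a / k), (b / k)]%classic :> set R.
Proof.
move=> k0; apply/seteqP; split => x /=; rewrite /mull !in_itv/=;
  by rewrite ltr_pdivrMr// ler_pdivlMr// mulrC.
Qed.

(** The pushforward under [mull a], multiplied by [a], gives each interval []x, y]] its length;
    uniqueness of Lebesgue measure does the rest. *)
Lemma lebesgue_measure_mull (a : R) (A : set RR) : 0 < a -> measurable A ->
  mu (mull a @^-1` A) = ((a^-1)%:E * mu A)%E.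
Proof.
move=> a0 mA.
pose nu := mscale (NngNum (ltW a0))
  (measure_function_pushforward__canonical__measure_function_Measure
     mu (measurable_mull a)).
have nuE : mu A = nu A.
  apply: lebesgue_measure_unique => // _ [[x y]] _ <-.
  transitivity (a%:E * mu (mull a @^-1` `]x, y]%classic))%E; last by [].
  rewrite preimage_mull_itvoc// !lebesgue_measure_itv/=.
  rewrite !lte_fin ltr_pM2r ?invr_gt0//; case: ifPn => [xy|]; last by rewrite mule0.
  rewrite -!EFinB -EFinM -mulrBl mulrCA divff ?gt_eqF// mulr1//.
have E : mu A = (a%:E * mu (mull a @^-1` A))%E by rewrite nuE.
by rewrite E muleA -EFinM mulVf ?gt_eqF// mul1e.
Qed.

Lemma ge0_integral_mull (a : R) (f : RR -> \bar R) : 0 < a ->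
  measurable_fun [set: RR] f -> (forall x, (0 <= f x)%E) ->
  (\int[mu]_x f (a * x)%R = (a^-1)%:E * \int[mu]_x f x)%E.
Proof.
move=> a0 mf f0.
have a0' : 0 <= a^-1 by rewrite invr_ge0 ltW.
rewrite -[(a^-1)%:E]/((NngNum a0')%:num%:E) -ge0_integral_mscale//.
rewrite -[LHS]/(\int[mu]_(x in mull a @^-1` setT)
   (f \o (mull a)) x)%E.
rewrite -(ge0_integral_pushforward (measurable_mull a))//.
apply: (@eq_measure_integral _ _ _ setT (mscale (NngNum a0') mu)
  (measure_function_pushforward__canonical__measure_function_Measure
     mu (measurable_mull a)) f) => A mA _.
exact: lebesgue_measure_mull.
Qed.

End LineScaling.

Section Space.
Context {R : realType}.
Local Notation mu := (@lebesgue_measure R).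
Local Notation RR := (measurableTypeR R).
Local Notation space := (@Defs.space R).

Definition dilate3 (a : R) (x : space) : space :=
  [tuple of map (mull a) x].

Definition dilate (a : R) N (q : N.-tuple space) : N.-tuple space :=
  [tuple of map (dilate3 a) q].

Definition normsqN N (q : N.-tuple space) : R := \sum_(i < N) normsq (tnth q i).

Lemma normsq_ge0 (x : space) : 0 <= normsq x.
Proof. by apply: sumr_ge0 => i _; exact: sqr_ge0. Qed.

Lemma normsqN_ge0 N (q : N.-tuple space) : 0 <= normsqN q.
Proof. by apply: sumr_ge0 => i _; exact: normsq_ge0. Qed.

Lemma normsq_dilate3 a (x : space) : normsq (dilate3 a x) = a ^+ 2 * normsq x.
Proof.
by rewrite /normsq mulr_sumr; apply: eq_bigr => k _; rewrite tnth_map exprMn.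
Qed.

Lemma normsqN_dilate a N (q : N.-tuple space) :
  normsqN (dilate a q) = a ^+ 2 * normsqN q.
Proof.
rewrite /normsqN mulr_sumr; apply: eq_bigr => i _.
by rewrite tnth_map normsq_dilate3.
Qed.

Lemma measurable_coord d (T : measurableType d) (f : T -> space) (k : 'I_3) :
  measurable_fun [set: T] f -> measurable_fun [set: T] (fun x => tnth (f x) k : R).
Proof.
move=> mf; apply: (measurableT_comp (f := fun y : space => tnth y k)) => //.
exact: measurable_tnth.
Qed.

Lemma measurable_normsq : measurable_fun [set: space] (@normsq R).
Proof.
apply: measurable_sum => k; apply: measurable_funX.
exact: measurable_coord.
Qed.

Lemma measurable_normsqN N : measurable_fun [set: N.-tuple space] (@normsqN N).
Proof.
apply: measurable_sum => k.
apply: (measurableT_comp (f := @normsq R)); first exact: measurable_normsq.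
exact: measurable_tnth.
Qed.

Lemma measurable_dilate3 a : measurable_fun [set: space] (dilate3 a).
Proof. by apply: measurable_map_tuple; exact: measurable_mull. Qed.

Lemma measurable_dilate a N : measurable_fun [set: N.-tuple space] (@dilate a N).
Proof. by apply: measurable_map_tuple; exact: measurable_dilate3. Qed.

Lemma lebesgue3N_dilate a N (A : set (N.-tuple space)) : 0 < a -> measurable A ->
  lebesgue3N N (@dilate a N @^-1` A) = ((a^-1 ^+ (3 * N))%:E * lebesgue3N N A)%E.
Proof.
move=> a0 mA.
have a0' : 0 <= a^-1 by rewrite invr_ge0 ltW.
have h3 (g : space -> \bar R) : measurable_fun [set: space] g ->
    (forall x, (0 <= g x)%E) ->
    (\int[@lebesgue3 R]_x g (dilate3 a x) =
     (a^-1 ^+ 3)%:E * \int[@lebesgue3 R]_x g x)%E.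
  move=> mg g0; apply: ge0_integral_map_tuple => //; first exact: measurable_mull.
  by move=> f mf f0; exact: ge0_integral_mull.
have mI : measurable_fun [set: N.-tuple space] (EFin \o (\1_A : _ -> R)).
  by apply/measurable_EFinP; exact: measurable_indic.
have I0 t : (0 <= (EFin \o (\1_A : N.-tuple space -> R)) t)%E.
  by rewrite lee_fin indicE.
have mpA : measurable (@dilate a N @^-1` A).
  by rewrite -[X in measurable X]setTI; exact: measurable_dilate.
rewrite -[X in lebesgue3N N X = _]setIT -[A in RHS]setIT -!integral_indic//.
rewrite exprM.
exact: (@ge0_integral_map_tuple _ _ _ (@lebesgue3 R) _ _ N _
   (exprn_ge0 3 a0') (measurable_dilate3 a) h3 mI I0).
Qed.

Definition cube (c : 'I_3 -> R) (b : R) : set space :=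
  [set x | forall k, (`[c k - b, c k + b]%classic : set RR) (tnth x k)].

Lemma lebesgue3_cube c b : 0 <= b -> @lebesgue3 R (cube c b) = ((2 * b) ^+ 3)%:E.
Proof.
move=> b0; rewrite (@tuple_measure_box _ _ _ mu 3
  (fun k => `[c k - b, c k + b]%classic) (fun=> 2 * b)).
- by rewrite big_const_ord iter_mulr_1.
- by move=> i; exact: measurable_itv.
move=> i; apply: etrans (lebesgue_measure_itv _) _; rewrite /= lte_fin.
case: ifPn => [_|].
  by rewrite -EFinB; congr EFin; ring.
by rewrite -leNgt => h; congr EFin; lra.
Qed.

Lemma measurable_cube c b : measurable (cube c b).
Proof.
rewrite (_ : cube c b = \bigcap_(k in [set: 'I_3])
   ((fun x : space => tnth x k) @^-1` `[c k - b, c k + b])); last first.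
  by apply/seteqP; split => t /= h; [move=> i _; exact: h|move=> i; exact: h].
apply: fin_bigcap_measurable => // k _; rewrite -[X in measurable X]setTI.
by apply: measurable_tnth => //; exact: measurable_itv.
Qed.

Definition cubeN N (b : R) : set (N.-tuple space) :=
  [set q | forall i, cube (fun=> 0) b (tnth q i)].

Lemma measurable_cubeN N b : measurable (@cubeN N b).
Proof.
rewrite (_ : cubeN b = \bigcap_(k in [set: 'I_N])
   ((fun x : N.-tuple space => tnth x k) @^-1` cube (fun=> 0) b)); last first.
  by apply/seteqP; split => t /= h; [move=> i _; exact: h|move=> i; exact: h].
apply: fin_bigcap_measurable => // k _; rewrite -[X in measurable X]setTI.
by apply: measurable_tnth => //; exact: measurable_cube.
Qed.

Lemma lebesgue3N_cubeN N b : 0 <= b ->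
  lebesgue3N N (@cubeN N b) = ((2 * b) ^+ (3 * N))%:E.
Proof.
move=> b0; rewrite (@tuple_measure_box _ _ _ (@lebesgue3 R) N
  (fun=> cube (fun=> 0) b) (fun=> (2 * b) ^+ 3)).
- by rewrite big_const_ord iter_mulr_1 exprM.
- by move=> i; exact: measurable_cube.
by move=> i; exact: lebesgue3_cube.
Qed.

Lemma integral_gaussN N :
  (\int[lebesgue3N N]_q (expR (- normsqN q))%:E = (Num.sqrt pi ^+ (3 * N))%:E)%E.
Proof.
have g3 : (\int[@lebesgue3 R]_x (expR (- normsq x))%:E = (Num.sqrt pi ^+ 3)%:E)%E.
  under eq_integral.
    move=> x _; rewrite /normsq -sumrN expR_sum.
    over.
  rewrite /lebesgue3 (@integral_tuple_prod _ _ _ _ 3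
     (fun=> fun u : RR => expR (- (u : R) ^+ 2)) (fun=> Num.sqrt pi)).
  - by rewrite big_const_ord iter_mulr_1.
  - by move=> _; exact: measurable_gauss_fun.
  - by move=> _ x; exact: expR_ge0.
  - by move=> _; exact: integralT_gauss.
under eq_integral do rewrite /normsqN -sumrN expR_sum.
rewrite /lebesgue3N (@integral_tuple_prod _ _ _ _ N
     (fun=> fun u : space => expR (- normsq u)) (fun=> Num.sqrt pi ^+ 3)).
- by rewrite big_const_ord iter_mulr_1 exprM.
- move=> _; apply: measurableT_comp; first exact: measurable_expR.
  by apply: measurable_funN; exact: measurable_normsq.
- by move=> _ x; exact: expR_ge0.
- by move=> _.
Qed.

End Space.

(** * The Gamma function *)

Section Gamma.
Context {R : realType}.
Local Notation mu := (@lebesgue_measure R).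
Local Notation RR := (measurableTypeR R).

(** Writing [expR (- r)] as the mass of a half-line is what makes the later double integrals
    accessible to Tonelli. *)
Lemma integral_expRN_tail (r : R) :
  (\int[mu]_(u in `[r, +oo[) (expR (- u))%:E = (expR (- r))%:E)%E.
Proof.
have cN : continuous (fun x : R => - expR (- x)).
  move=> x; apply: differentiable_continuous.
  by apply/derivable1_diffP; exact: ex_derive.
rewrite (@ge0_continuous_FTC2y _ _ (fun x => - expR (- x)) _ 0)//.
- by rewrite -EFinB sub0r opprK.
- apply: continuous_subspaceT => x; apply: differentiable_continuous.
  by apply/derivable1_diffP; exact: ex_derive.
- rewrite -oppr0; apply: cvgN; exact: cvgr_expR.
- by apply: cvg_at_right_filter; exact: cN.
- move=> x _; rewrite derive1E derive_val.
  by rewrite /GRing.scale/= mulrN1 opprK.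
Qed.

(** This is Gamma(s + 1): ball volumes grow like [u ^ s], so the exponent is not shifted. The value
    is an extended real because finiteness only follows later, from the Gaussian integral. *)
Definition gamma_integral (s : R) : \bar R :=
  (\int[mu]_(t in `]0%R, +oo[) (t `^ s * expR (- t))%:E)%E.

Lemma measurable_powR_expRN (s : R) :
  measurable_fun [set: RR] (fun t : RR => (t : R) `^ s * expR (- (t : R))).
Proof.
apply: measurable_funM; first exact: measurable_powR.
by apply: measurableT_comp; [exact: measurable_expR|exact: oppr_measurable].
Qed.

(** With [1 < s] the integrand is continuous up to 0, where it vanishes, so the fundamental theorem
    applies on the closed interval. *)
Lemma integral_powR (s t : R) : 1 < s -> 0 < t ->
  (\int[mu]_(u in `]0%R, t]) (s * u `^ (s - 1))%:E = (t `^ s)%:E)%E.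
Proof.
move=> s1 t0.
have s0 : 0 < s by lra.
have cp (a x : R) : 0 < x -> {for x, continuous (fun u : R => u `^ a)}.
  move=> x0; apply: differentiable_continuous; apply/derivable1_diffP.
  by apply: ex_derive; exact: is_derive1_powR.
have cf (x : R) : 0 < x -> {for x, continuous (fun u : R => s * u `^ (s - 1))}.
  by move=> x0; apply: (@continuousM R R); [exact: cst_continuous|exact: cp].
rewrite integral_itv_obnd_cbnd; last first.
  apply/measurable_EFinP; apply: measurable_funM => //.
  exact: (measurable_funTS (measurable_powR _)).
rewrite (@continuous_FTC2 _ _ (fun u => u `^ s))//.
- by rewrite powR0 ?sube0// gt_eqF.
- apply/continuous_within_itvP => //; split.
  + by move=> x; rewrite in_itv/= => /andP[x0 _]; exact: cf.
  + rewrite powR0 ?subr_eq0 ?gt_eqF// mulr0 -[X in _ --> X](mulr0 s).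
    by apply: cvgMr; apply: powR_cvg0; rewrite subr_gt0.
  + by apply: cvg_at_left_filter; exact: cf.
- split.
  + move=> x; rewrite in_itv/= => /andP[x0 _].
    by apply: ex_derive; exact: is_derive1_powR.
  + by rewrite powR0 ?gt_eqF//; exact: powR_cvg0.
  + by apply: cvg_at_left_filter; exact: cp.
- by move=> x; rewrite in_itv/= => /andP[x0 _]; rewrite powR_derive1// in_itv/= x0.
Qed.

(** Instead of integrating by parts, [s * u ^ (s - 1) * expR (- t)] is integrated over [0 < u <= t]
    in both orders. By Tonelli this is valid even for infinite values. *)
Lemma gamma_integralS (s : R) : 1 < s ->
  gamma_integral s = (s%:E * gamma_integral (s - 1))%E.
Proof.
move=> s1.
have s0 : 0 < s by lra.
pose f (z : RR * RR) : \bar R :=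
  ((s * z.2 `^ (s - 1) * expR (- z.1)) * ((0 < z.2) && (z.2 <= z.1))%:R)%:E.
have mf : measurable_fun setT f.
  apply/measurable_EFinP; apply: measurable_funM.
    apply: measurable_funM.
      apply: measurable_funM => //.
      by apply: (measurableT_comp (measurable_powR _)) => //; exact: measurable_snd.
    apply: measurableT_comp; first exact: measurable_expR.
    by apply: measurable_funN; exact: measurable_fst.
  apply: (measurableT_comp (f := fun b : bool => (b%:R : R))) => //.
  apply: measurable_and.
    by apply: measurable_fun_ltr => //; exact: measurable_snd.
  by apply: measurable_fun_ler; [exact: measurable_snd|exact: measurable_fst].
have f0 z : (0 <= f z)%E.
  by rewrite lee_fin mulr_ge0// mulr_ge0 ?expR_ge0// mulr_ge0 ?powR_ge0// ltW.
have Ft t : (\int[mu]_u f (t, u) =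
    ((fun t => (t `^ s * expR (- t))%:E) \_ `]0%R, +oo[) t)%E.
  rewrite patchE mem_setE in_itv/= andbT; case: ifPn => [t0|].
    transitivity (\int[mu]_(u in `]0%R, t]) ((s * u `^ (s - 1))%:E * (expR (- t))%:E))%E.
      rewrite [RHS]integral_mkcond; apply: eq_integral => u _.
      rewrite patchE mem_setE in_itv/= /f/=.
      by case: ifPn => _; rewrite ?mulr1 ?mulr0.
    rewrite ge0_integralZr//.
    - by rewrite integral_powR.
    - apply/measurable_EFinP; apply: measurable_funM => //.
      exact: (measurable_funTS (measurable_powR _)).
    - by move=> u _; rewrite lee_fin mulr_ge0 ?powR_ge0// ltW.
  rewrite -leNgt => t0; rewrite integral0_eq// => u _; rewrite /f/=.
  case: ltP => u0; last by rewrite mulr0.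
  by rewrite leNgt (le_lt_trans t0 u0) mulr0.
have Gu u : (\int[mu]_t f (t, u) =
    ((fun t => s%:E * (t `^ (s - 1) * expR (- t))%:E) \_ `]0%R, +oo[) u)%E.
  rewrite patchE mem_setE in_itv/= andbT; case: ifPn => [u0|].
    transitivity (\int[mu]_(t in `[u, +oo[) ((s * u `^ (s - 1))%:E * (expR (- t))%:E))%E.
      rewrite [RHS]integral_mkcond; apply: eq_integral => t _.
      rewrite patchE mem_setE in_itv/= /f/= u0 andbT.
      by case: ifPn => _; rewrite ?mulr1 ?mulr0.
    rewrite ge0_integralZl//.
    - by rewrite integral_expRN_tail -!EFinM mulrA.
    - apply/measurable_EFinP; apply: measurableT_comp; first exact: measurable_expR.
      exact: oppr_measurable.
    - by rewrite lee_fin mulr_ge0 ?powR_ge0// ltW.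
  move=> /negbTE u0; rewrite integral0_eq// => t _; rewrite /f/=.
  by rewrite u0 mulr0.
have := fubini_tonelli (m1 := mu) (m2 := mu) f mf f0.
under eq_integral do rewrite Ft.
under [RHS]eq_integral do rewrite Gu.
rewrite -!integral_mkcond /gamma_integral => ->.
rewrite ge0_integralZl//.
- exact: (measurable_funTS (measurableT_comp (@EFin_measurable R setT)
    (measurable_powR_expRN _))).
- by move=> t _; rewrite lee_fin mulr_ge0 ?powR_ge0 ?expR_ge0.
- by rewrite lee_fin ltW.
Qed.

(** Only the tail [t >= s] is kept, where [t ^ s >= s ^ s]. This crude form of Stirling's bound
    suffices for the volume of the unit ball. *)
Lemma gamma_integral_ge (s : R) : 0 < s ->
  ((s `^ s * expR (- s))%:E <= gamma_integral s)%E.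
Proof.
move=> s0; rewrite EFinM -integral_expRN_tail -ge0_integralZl//; last 2 first.
- apply/measurable_EFinP; apply: measurableT_comp; first exact: measurable_expR.
  exact: oppr_measurable.
- by rewrite lee_fin powR_ge0.
apply: (@le_trans _ _ (\int[mu]_(t in `[s, +oo[) (t `^ s * expR (- t))%:E)%E).
  apply: ge0_le_integral => //.
  - by move=> t _; rewrite -EFinM lee_fin mulr_ge0 ?powR_ge0 ?expR_ge0.
  - apply/measurable_EFinP; apply: measurable_funM => //.
    apply: measurableT_comp; first exact: measurable_expR.
    exact: oppr_measurable.
  - exact: (measurable_funTS (measurableT_comp (@EFin_measurable R setT)
      (measurable_powR_expRN _))).
  - move=> t /=; rewrite in_itv/= andbT => st.
    rewrite -EFinM lee_fin ler_wpM2r ?expR_ge0// ge0_ler_powR// ?nnegrE ltW//.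
    exact: lt_le_trans st.
apply: ge0_subset_integral => //.
- exact: (measurable_funTS (measurableT_comp (@EFin_measurable R setT)
    (measurable_powR_expRN _))).
- by move=> t _; rewrite lee_fin mulr_ge0 ?powR_ge0 ?expR_ge0.
by move=> t /=; rewrite !in_itv/= !andbT; exact: lt_le_trans.
Qed.

End Gamma.

(** * Volumes of balls and shells *)

Lemma ler_norm_sqr (R : realDomainType) (x b : R) : 0 <= b ->
  (`|x| <= b) = (x ^+ 2 <= b ^+ 2).
Proof. by move=> b0; rewrite -[x ^+ 2]real_normK ?num_real// ler_sqr// nnegrE. Qed.

Section BallVolume.
Context {R : realType} (N : nat).
Hypothesis N_gt0 : (0 < N)%N.
Local Notation RR := (measurableTypeR R).
Local Notation space := (@Defs.space R).
Local Notation vol := (@lebesgue3N R N).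
Let s : R := 3 * N%:R / 2.

Definition unit_ball_volume : R :=
  fine (vol [set q | normsqN q <= 1]).

Let s_gt0 : 0 < s.
Proof. by rewrite /s divr_gt0// mulr_gt0// ltr0n. Qed.

Lemma measurable_normsqN_le (t : R) :
  measurable [set q : N.-tuple space | normsqN q <= t].
Proof.
rewrite -[X in measurable X]setTI.
rewrite (_ : [set q | _] = @normsqN R N @^-1` `]-oo, t]); last first.
  by apply/seteqP; split => q /=; rewrite in_itv.
by apply: measurable_normsqN => //; exact: measurable_itv.
Qed.

Lemma measurable_normsqN_lt (t : R) :
  measurable [set q : N.-tuple space | normsqN q < t].
Proof.
rewrite -[X in measurable X]setTI.
rewrite (_ : [set q | _] = @normsqN R N @^-1` `]-oo, t[); last first.
  by apply/seteqP; split => q /=; rewrite in_itv.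
by apply: measurable_normsqN => //; exact: measurable_itv.
Qed.

Lemma sqrt_expr3N (t : R) : 0 <= t -> Num.sqrt t ^+ (3 * N) = t `^ s.
Proof.
move=> t0; rewrite -powR12_sqrt// -powR_mulrn ?powR_ge0// -powRrM.
by congr (_ `^ _); rewrite natrM /s; field.
Qed.

(** The predicate [P] lets closed and open balls share one scaling argument. *)
Lemma vol_normsqN_dilate (P : R -> bool) (t : R) : 0 < t ->
  measurable [set q : N.-tuple space | P (normsqN q)] ->
  vol [set q | P (normsqN q / t)] = ((t `^ s)%:E * vol [set q | P (normsqN q)])%E.
Proof.
move=> t0 mP.
have st0 : 0 < Num.sqrt t by rewrite sqrtr_gt0.
rewrite -sqrt_expr3N ?ltW// -{1}[Num.sqrt t]invrK -lebesgue3N_dilate ?invr_gt0//.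
congr (vol _); apply/seteqP; split => q /=;
  by rewrite normsqN_dilate exprVn sqr_sqrtr ?ltW// mulrC.
Qed.

Lemma coord_le_normsqN (q : N.-tuple space) (i : 'I_N) (k : 'I_3) :
  (tnth (tnth q i) k : R) ^+ 2 <= normsqN q.
Proof.
rewrite /normsqN (bigD1 i)//= -[leLHS]addr0 lerD ?sumr_ge0//; last first.
  by move=> j _; exact: normsq_ge0.
rewrite /normsq (bigD1 k)//= -[leLHS]addr0 lerD ?sumr_ge0//.
by move=> j _; exact: sqr_ge0.
Qed.

Lemma normsqN_le_cubeN (b : R) : 0 <= b ->
  [set q : N.-tuple space | normsqN q <= b ^+ 2] `<=` cubeN b.
Proof.
move=> b0 q /= qb i k /=; rewrite in_itv/= sub0r add0r -ler_norml.
by rewrite ler_norm_sqr// (le_trans (coord_le_normsqN _ _ _) qb).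
Qed.

Lemma cubeN_normsqN_le (b : R) (q : N.-tuple space) : 0 <= b ->
  cubeN b q -> normsqN q <= 3 * N%:R * b ^+ 2.
Proof.
move=> b0 qb.
have h i : normsq (tnth q i) <= 3 * b ^+ 2.
  rewrite /normsq (le_trans (y := \sum_(k < 3) b ^+ 2))//.
    apply: ler_sum => k _; have := qb i k; rewrite /= in_itv/= sub0r add0r -ler_norml.
    by rewrite ler_norm_sqr.
  by rewrite sumr_const card_ord mulr_natl.
rewrite (le_trans (y := \sum_(i < N) 3 * b ^+ 2))//; first exact: ler_sum.
by rewrite sumr_const card_ord -mulrA [N%:R * _]mulr_natl mulrnAr.
Qed.

Lemma unit_ball_volumeE :
  vol [set q | normsqN q <= 1] = unit_ball_volume%:E.
Proof.
rewrite /unit_ball_volume fineK// ge0_fin_numE//.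
apply: (@le_lt_trans _ _ (vol (cubeN 1))).
  apply: le_measure; rewrite ?inE.
  - exact: measurable_normsqN_le.
  - exact: measurable_cubeN.
  by have := @normsqN_le_cubeN 1 ler01; rewrite expr1n.
by rewrite lebesgue3N_cubeN// ltry.
Qed.

Lemma unit_ball_volume_gt0 : 0 < unit_ball_volume.
Proof.
have N0 : 0 < 3 * N%:R :> R by rewrite mulr_gt0// ltr0n.
have b0 : 0 < (3 * N%:R)^-1 :> R by rewrite invr_gt0.
apply: (@lt_le_trans _ _ ((2 * (3 * N%:R)^-1) ^+ (3 * N))).
  by rewrite exprn_gt0// mulr_gt0.
rewrite -lee_fin -unit_ball_volumeE -lebesgue3N_cubeN; last exact: ltW.
apply: le_measure; rewrite ?inE.
- exact: measurable_cubeN.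
- exact: measurable_normsqN_le.
move=> q /cubeN_normsqN_le -/(_ (ltW b0)) /le_trans; apply.
rewrite expr2 mulrA divff ?gt_eqF// mul1r invf_le1//.
by have : 1 <= N%:R :> R by [rewrite ler1n]; lra.
Qed.

Lemma vol_ball (t : R) :
  vol [set q | normsqN q <= t] = (unit_ball_volume * pos_powR t s)%:E.
Proof.
have [t0|t0] := leP t 0.
  rewrite /pos_powR (max_idPr t0) powR0 ?gt_eqF// mulr0.
  apply/eqP; rewrite eq_le measure_ge0 andbT.
  (* For [t <= 0] the ball lies in the degenerate cube, whose volume [0 ^+ (3 * N)] is 0 because
     [N > 0]. *)
  have c0 : vol (@cubeN R N 0) = 0%:E.
    by rewrite lebesgue3N_cubeN// mulr0 expr0n muln_eq0/= gtn_eqF.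
  rewrite -[leRHS]c0.
  apply: le_measure; rewrite ?inE.
  - exact: measurable_normsqN_le.
  - exact: measurable_cubeN.
  move=> q /= qt; apply: normsqN_le_cubeN => //=.
  by rewrite expr0n (le_trans qt).
rewrite /pos_powR (max_idPl (ltW t0)) mulrC EFinM -unit_ball_volumeE.
rewrite -(@vol_normsqN_dilate (fun x => x <= 1))//; last exact: measurable_normsqN_le.
by congr (vol _); apply/seteqP; split => q /=; rewrite ler_pdivrMr// mul1r.
Qed.

(** Spheres are null sets by scaling alone: if the open ball were smaller than the closed one, a
    closed ball of intermediate volume would fit into it. This is what makes the volume of a shell
    closed on both sides computable. *)
Lemma vol_open_unit_ball : vol [set q | normsqN q < 1] = unit_ball_volume%:E.
Proof.
have c0 := unit_ball_volume_gt0.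
have le1 : (vol [set q | (normsqN q < 1)%R] <= unit_ball_volume%:E)%E.
  rewrite -unit_ball_volumeE; apply: le_measure; rewrite ?inE.
  - exact: measurable_normsqN_lt.
  - exact: measurable_normsqN_le.
  by move=> q /= /ltW.
have fo : vol [set q | normsqN q < 1] \is a fin_num.
  by rewrite ge0_fin_numE// (le_lt_trans le1)// ltry.
apply/eqP; rewrite eq_le le1/= -(fineK fo) lee_fin leNgt; apply/negP => h.
set o := fine _ in h.
have o0 : 0 <= o by exact: fine_ge0.
(* The closed ball of squared radius [c' ^ (1 / s)] has volume [(o + unit_ball_volume) / 2 > o], yet
   lies in the open unit ball. *)
pose c' := (o + unit_ball_volume) / 2 / unit_ball_volume.
have c'0 : 0 < c' by rewrite !divr_gt0// ltr_wpDl.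
have c'1 : c' < 1 by rewrite ltr_pdivrMr// mul1r; lra.
have t1 : c' `^ s^-1 < 1.
  have : c' `^ s^-1 < 1 `^ s^-1 by rewrite gt0_ltr_powR ?invr_gt0// nnegrE ltW.
  by rewrite powR1.
have : (vol [set q | (normsqN q <= c' `^ s^-1)%R] <= o%:E)%E.
  rewrite /o fineK//; apply: le_measure; rewrite ?inE.
  - exact: measurable_normsqN_le.
  - exact: measurable_normsqN_lt.
  by move=> q /= /le_lt_trans; apply.
rewrite vol_ball lee_fin /pos_powR (max_idPl _) ?powR_ge0//.
rewrite -powRrM mulVf ?gt_eqF// powRr1; last exact: ltW.
rewrite mulrC /c' divfK ?gt_eqF//.
by rewrite leNgt => /negP; apply; lra.
Qed.

Lemma vol_open_ball (t : R) :
  vol [set q | normsqN q < t] = (unit_ball_volume * pos_powR t s)%:E.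
Proof.
have [t0|t0] := leP t 0.
  rewrite /pos_powR (max_idPr t0) powR0 ?gt_eqF// mulr0.
  rewrite (_ : [set q | _] = set0) ?measure0//.
  apply/seteqP; split => q //= qt.
  by have := lt_le_trans qt t0; rewrite ltNge normsqN_ge0.
rewrite /pos_powR (max_idPl (ltW t0)) mulrC EFinM -vol_open_unit_ball.
rewrite -(@vol_normsqN_dilate (fun x => x < 1))//; last exact: measurable_normsqN_lt.
by congr (vol _); apply/seteqP; split => q /=; rewrite ltr_pdivrMr// mul1r.
Qed.

Lemma vol_shell (a b : R) : a <= b ->
  vol [set q | a <= normsqN q <= b] =
  (unit_ball_volume * (pos_powR b s - pos_powR a s))%:E.
Proof.
move=> ab; rewrite mulrBr EFinB -vol_ball -vol_open_ball.
have fb : (vol [set q | (normsqN q <= b)%R] < +oo)%E by rewrite vol_ball ltry.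
rewrite (_ : [set q | a <= normsqN q <= b] =
  [set q | normsqN q <= b] `\` [set q | normsqN q < a]); last first.
  apply/seteqP; split => q /=.
    by move=> /andP[qa qb]; split => //; rewrite ltNge qa.
  by move=> [-> /negP]; rewrite -leNgt andbT.
apply: etrans (measureD (mu := vol) (measurable_normsqN_le b)
  (measurable_normsqN_lt a) fb) _.
congr (_ - _)%E; congr (vol _); apply/seteqP; split => q /=; first by case.
by move=> qa; split => //; rewrite (le_trans (ltW qa)).
Qed.

(* Layer cake: [expR (- r)] is the mass of [r, +oo) for the density [expR (- u)],
   so the Gaussian integral is the integral of the ball volumes. *)
Lemma unit_ball_volume_gamma :
  (unit_ball_volume%:E * gamma_integral s = (pi `^ s)%:E)%E.
Proof.
rewrite -sqrt_expr3N ?pi_ge0// -integral_gaussN.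
pose f (z : N.-tuple space * RR) : \bar R :=
  (expR (- z.2) * (normsqN z.1 <= z.2)%R%:R)%:E.
have mf : measurable_fun setT f.
  apply/measurable_EFinP; apply: measurable_funM.
    apply: measurableT_comp; first exact: measurable_expR.
    by apply: measurable_funN; exact: measurable_snd.
  apply: (measurableT_comp (f := fun b : bool => (b%:R : R))) => //.
  apply: measurable_fun_ler; last exact: measurable_snd.
  apply: (measurableT_comp (f := @normsqN R N)); first exact: measurable_normsqN.
  exact: measurable_fst.
have f0 z : (0 <= f z)%E by rewrite lee_fin mulr_ge0 ?expR_ge0.
have Fq q : (\int[lebesgue_measure]_u f (q, u) = (expR (- normsqN q))%:E)%E.
  rewrite -integral_expRN_tail [RHS]integral_mkcond; apply: eq_integral => u _.
  rewrite patchE mem_setE in_itv/= andbT /f/=.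
  by case: ifPn => _; rewrite ?mulr1 ?mulr0.
have Gu u : (\int[vol]_q f (q, u) =
    ((fun u => unit_ball_volume%:E * (u `^ s * expR (- u))%:E) \_ `]0%R, +oo[) u)%E.
  transitivity ((expR (- u))%:E * vol [set q | (normsqN q <= u)%R])%E.
    rewrite -[X in vol X]setIT -(integral_indic vol measurableT); last exact: measurable_normsqN_le.
    rewrite -ge0_integralZl//.
    - apply: eq_integral => q _; rewrite /f -EFinM indicE/=; congr (_ * _)%:E.
      by rewrite mem_setE.
    - apply/measurable_EFinP; apply: measurable_indic.
      exact: measurable_normsqN_le.
  rewrite vol_ball patchE mem_setE in_itv/= andbT.
  case: ltP => u0; last by rewrite /pos_powR (max_idPr u0) powR0 ?gt_eqF// mulr0 mule0.
  by rewrite /pos_powR (max_idPl (ltW u0)) -!EFinM mulrCA [_ * expR _]mulrC.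
have := fubini_tonelli (m1 := vol) (m2 := lebesgue_measure) f mf f0.
under eq_integral do rewrite Fq.
under [RHS]eq_integral do rewrite Gu.
rewrite -!integral_mkcond => ->.
rewrite /gamma_integral ge0_integralZl//.
- exact: (measurable_funTS (measurableT_comp (@EFin_measurable R setT)
    (measurable_powR_expRN _))).
- by move=> t _; rewrite lee_fin mulr_ge0 ?powR_ge0 ?expR_ge0.
- by rewrite lee_fin ltW// unit_ball_volume_gt0.
Qed.

Let s_gt1 : 1 < s.
Proof. by rewrite /s; have : 1 <= N%:R :> R by [rewrite ler1n]; lra. Qed.

(** [euler_gamma] is the [fine] part of an extended-real integral, so finiteness has to be proved:
    an infinite value would make the left side of [unit_ball_volume_gamma] infinite. *)
Lemma euler_gammaE : gamma_integral (s - 1) = (euler_gamma s)%:E.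
Proof.
rewrite /euler_gamma /Rintegral fineK// ge0_fin_numE; last first.
  by apply: integral_ge0 => t _; rewrite lee_fin mulr_ge0 ?powR_ge0 ?expR_ge0.
rewrite ltNge leye_eq; apply/eqP => h.
have := unit_ball_volume_gamma.
rewrite gamma_integralS// /gamma_integral h gt0_muley ?lte_fin//.
by rewrite gt0_muley// lte_fin unit_ball_volume_gt0.
Qed.

(** The Gaussian identity reads [c * s * Gamma(s) = pi ^ s] with [c] the ball volume, hence
    [2 * pi ^ s / Gamma(s) = 2 * s * c], and [2 * s = 3 * N]. *)
Lemma unit_ball_volume_sphere_area :
  sphere_area N = 3 * N%:R * unit_ball_volume.
Proof.
have := unit_ball_volume_gamma.
rewrite gamma_integralS// euler_gammaE -!EFinM => -[] h.
have g0 : euler_gamma s != 0.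
  apply/eqP => g0; have := powR_gt0 s (@pi_gt0 R).
  by rewrite -h g0 !mulr0 ltxx.
by rewrite /sphere_area -/s -h /s; field.
Qed.

Lemma unit_ball_volume_le : unit_ball_volume <= (pi * expR 1 / s) `^ s.
Proof.
have c0 := unit_ball_volume_gt0.
have := lee_wpmul2l (x := unit_ball_volume%:E) _ (gamma_integral_ge s_gt0).
rewrite lee_fin ltW// => /(_ isT); rewrite unit_ball_volume_gamma -EFinM lee_fin.
rewrite -ler_pdivlMr ?mulr_gt0 ?powR_gt0 ?expR_gt0// => /le_trans; apply.
rewrite ler_pdivrMr ?mulr_gt0 ?powR_gt0 ?expR_gt0// mulrA.
rewrite -powRM; last 2 first.
- by rewrite divr_ge0 ?mulr_ge0 ?pi_ge0 ?expR_ge0// ltW.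
- exact: ltW.
rewrite divfK ?gt_eqF// powRM ?pi_ge0 ?expR_ge0// -expRM mul1r.
by rewrite -mulrA -expRD subrr expR0 mulr1.
Qed.

End BallVolume.

(** * Smoothed powers of the positive part *)

Section PowerQuotient.
Context {R : realType}.

(** Mean value theorem. The case [b = 0] must be covered because positive parts may vanish; there
    only continuity at the left endpoint is used. *)
Lemma powR_sub_bounds (r a b : R) : 1 < r -> 0 <= b -> b <= a ->
  r * b `^ (r - 1) * (a - b) <= a `^ r - b `^ r <= r * a `^ (r - 1) * (a - b).
Proof.
move=> r1 b0; have r0 : 0 < r by lra.
rewrite le_eqVlt => /predU1P[->|ba]; first by rewrite !subrr !mulr0 lexx.
have cp (x : R) : 0 < x -> {for x, continuous (fun u : R => u `^ r)}.
  move=> x0; apply: differentiable_continuous; apply/derivable1_diffP.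
  by apply: ex_derive; exact: is_derive1_powR.
have [||c] := @MVT R (fun u => u `^ r) (fun u => r * u `^ (r - 1)) b a ba.
- move=> x; rewrite in_itv/= => /andP[bx _].
  by apply: is_derive1_powR; exact: le_lt_trans bx.
- apply/continuous_within_itvP => //; split.
  + move=> x; rewrite in_itv/= => /andP[bx _].
    by apply: cp; exact: le_lt_trans bx.
  + move: b0; rewrite le_eqVlt => /predU1P[<-|b0].
      by rewrite powR0 ?gt_eqF//; exact: powR_cvg0.
    by apply: cvg_at_right_filter; exact: cp.
  + by apply: cvg_at_left_filter; apply: cp; exact: le_lt_trans ba.
rewrite in_itv/= => /andP[bc ca] ->.
have c0 := le_lt_trans b0 bc.
have a0 := lt_trans c0 ca.
have h1 : b `^ (r - 1) <= c `^ (r - 1).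
  by apply: ge0_ler_powR; rewrite ?nnegrE; lra.
have h2 : c `^ (r - 1) <= a `^ (r - 1).
  by apply: ge0_ler_powR; rewrite ?nnegrE; lra.
by apply/andP; split; rewrite ler_wpM2r ?subr_ge0 ?(ltW ba)// ler_wpM2l// ltW.
Qed.

Lemma pos_powR_ge0 (x r : R) : 0 <= pos_powR x r.
Proof. exact: powR_ge0. Qed.

Lemma le_pos_powR (r : R) : 0 <= r -> {homo pos_powR ^~ r : x y / x <= y}.
Proof.
move=> r0 x y xy; apply: ge0_ler_powR => //.
- by rewrite nnegrE le_max lexx orbT.
- by rewrite nnegrE le_max lexx orbT.
- by rewrite ge_max !le_max xy lexx orbT.
Qed.

Lemma pos_powRM (k x r : R) : 0 <= k -> pos_powR (k * x) r = k `^ r * pos_powR x r.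
Proof.
move=> k0; rewrite /pos_powR -powRM ?le_max ?lexx ?orbT//.
by rewrite maxr_pMr// mulr0.
Qed.

(** Central difference quotient of the [r]-th power of the positive part. Up to a constant it is the
    momentum integral of [delta_approx eta], and its limit is [r * pos_powR K (r - 1)]. *)
Definition pos_powR_quot (r K eta : R) : R :=
  (2 * eta)^-1 * (pos_powR (K + eta) r - pos_powR (K - eta) r).

(** The positive part is 1-Lipschitz, so its increment is at most [2 * eta], which gives the upper
    bound. When [K - eta > 0] the increment equals [2 * eta]; otherwise the lower bound is 0. *)
Lemma pos_powR_quot_bounds (r K eta : R) : 1 < r -> 0 < eta ->
  r * pos_powR (K - eta) (r - 1) <= pos_powR_quot r K eta
    <= r * pos_powR (K + eta) (r - 1).
Proof.
move=> r1 e0; have r0 : 0 < r by lra.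
have b0 : 0 <= Num.max (K - eta) 0 by rewrite le_max lexx orbT.
have ba : Num.max (K - eta) 0 <= Num.max (K + eta) 0.
  by rewrite ge_max !le_max lexx orbT andbT; apply/orP; left; lra.
have /andP[lo hi] := powR_sub_bounds r1 b0 ba.
rewrite /pos_powR_quot [(2 * eta)^-1 * _]mulrC ler_pdivlMr ?mulr_gt0// ler_pdivrMr ?mulr_gt0//.
apply/andP; split; last first.
  apply: (le_trans hi); rewrite ler_wpM2l ?mulr_ge0 ?powR_ge0 ?(ltW r0)//.
  by case: (leP (K - eta) 0) => ?; case: (leP (K + eta) 0) => ?; lra.
have [h|h] := leP (K - eta) 0.
  rewrite /pos_powR (max_idPr h) !powR0 ?gt_eqF ?subr_gt0// mulr0 mul0r subr0.
  exact: powR_ge0.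
apply: le_trans lo; rewrite ler_wpM2l ?mulr_ge0 ?powR_ge0 ?(ltW r0)//.
by rewrite (max_idPl (ltW h)); case: (leP (K + eta) 0) => ?; lra.
Qed.

(** Both the quotient and its limit lie between the two bounds of [pos_powR_quot_bounds]. Their gap
    is estimated by the mean value bounds for the exponent [r - 1], whence [2 < r]. The rate depends
    on [K] only through [B], so it is uniform. *)
Lemma pos_powR_quot_dist (r K B eta : R) : 2 < r -> 0 < eta <= 1 -> K <= B -> 0 <= B ->
  `|pos_powR_quot r K eta - r * pos_powR K (r - 1)|
    <= 2 * r * (r - 1) * (B + 1) `^ (r - 2) * eta.
Proof.
move=> r2 /andP[e0 e1] KB B0; have r0 : 0 < r by lra.
have r1 : 1 < r by lra.
have r10 : 0 <= r - 1 by lra.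
have /andP[lo hi] := pos_powR_quot_bounds K r1 e0.
have lo' : r * pos_powR (K - eta) (r - 1) <= r * pos_powR K (r - 1).
  by rewrite ler_wpM2l ?(ltW r0)// le_pos_powR//; lra.
have hi' : r * pos_powR K (r - 1) <= r * pos_powR (K + eta) (r - 1).
  by rewrite ler_wpM2l ?(ltW r0)// le_pos_powR//; lra.
have b0 : 0 <= Num.max (K - eta) 0 by rewrite le_max lexx orbT.
have ba : Num.max (K - eta) 0 <= Num.max (K + eta) 0.
  by rewrite ge_max !le_max lexx orbT andbT; apply/orP; left; lra.
have r11 : 1 < r - 1 by lra.
have /andP[_] := powR_sub_bounds r11 b0 ba.
rewrite (_ : r - 1 - 1 = r - 2); last by ring.
rewrite -/(pos_powR (K + eta) (r - 1)) -/(pos_powR (K - eta) (r - 1)).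
rewrite -/(pos_powR (K + eta) (r - 2)).
set x := pos_powR (K + eta) (r - 1) in hi hi' *.
set y := pos_powR (K - eta) (r - 1) in lo lo' *.
move=> xy.
have D : Num.max (K + eta) 0 - Num.max (K - eta) 0 <= 2 * eta.
  by case: (leP (K - eta) 0) => ?; case: (leP (K + eta) 0) => ?; lra.
have P : pos_powR (K + eta) (r - 2) <= (B + 1) `^ (r - 2).
  have B1 : 0 <= B + 1 by lra.
  have -> : (B + 1) `^ (r - 2) = pos_powR (B + 1) (r - 2).
    by rewrite /pos_powR (max_idPl B1).
  by apply: le_pos_powR; lra.
have xy' : x - y <= (r - 1) * (B + 1) `^ (r - 2) * (2 * eta).
  apply: (le_trans xy); apply: ler_pM => //.
  - by rewrite mulr_ge0 ?pos_powR_ge0.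
  - by rewrite subr_ge0.
  - by rewrite ler_wpM2l.
have : r * (x - y) <= r * ((r - 1) * (B + 1) `^ (r - 2) * (2 * eta)).
  by rewrite ler_wpM2l// ltW.
rewrite ler_norml.
rewrite (_ : r * ((r - 1) * (B + 1) `^ (r - 2) * (2 * eta))
  = 2 * r * (r - 1) * (B + 1) `^ (r - 2) * eta); last by ring.
set Z := _ * eta; move: lo hi lo' hi'.
by rewrite mulrBr => *; apply/andP; split; lra.
Qed.

End PowerQuotient.

(** * Uniform convergence under the integral sign *)

Section UniformIntegral.
Context d (T : measurableType d) (R : realType).
Variable mu : {measure set T -> \bar R}.

(** The integrals stay within [C * eta * mu A] of the limit, and [mu A] is finite. The bound [M]
    makes the limit finite, so that it can be subtracted in the extended reals. *)
Lemma cvg_integral_unif (A : set T) (F : R -> T -> R) (G : T -> R) (C M : R) :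
  measurable A -> (mu A < +oo)%E -> 0 <= C ->
  (forall eta, 0 < eta <= 1 -> measurable_fun A (F eta)) ->
  measurable_fun A G ->
  (forall eta x, 0 < eta <= 1 -> A x -> 0 <= F eta x) ->
  (forall x, A x -> 0 <= G x <= M) ->
  (forall eta x, 0 < eta <= 1 -> A x -> `|F eta x - G x| <= C * eta) ->
  (\int[mu]_(x in A) (F eta x)%:E)%E @[eta --> 0^'+] -->
  (\int[mu]_(x in A) (G x)%:E)%E.
Proof.
move=> mA muA C0 mF mG F0 G0 FG.
have muA_fin : mu A \is a fin_num by rewrite ge0_fin_numE.
have G0' x : A x -> (0 <= (G x)%:E)%E by move=> /G0; rewrite lee_fin => /andP[].
set L := (\int[mu]_(x in A) (G x)%:E)%E.
have L0 : (0 <= L)%E by exact: integral_ge0.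
have Lfin : L \is a fin_num.
  rewrite ge0_fin_numE// (@le_lt_trans _ _ (\int[mu]_(x in A) M%:E)%E)//.
    apply: ge0_le_integral => //; first exact/measurable_EFinP.
    by move=> x /G0; rewrite lee_fin => /andP[].
  by rewrite integral_cst// ltey_eq fin_numM.
have addcst (H : T -> R) eta : 0 < eta -> measurable_fun A H ->
    (forall x, A x -> 0 <= H x) ->
    (\int[mu]_(x in A) (H x + C * eta)%:E =
     \int[mu]_(x in A) (H x)%:E + (C * eta)%:E * mu A)%E.
  move=> e0 mH H0.
  under eq_integral do rewrite EFinD.
  rewrite ge0_integralD//.
  - by rewrite integral_cst.
  - exact/measurable_EFinP.
  - by move=> x _; rewrite lee_fin mulr_ge0// ltW.
have hi eta : 0 < eta <= 1 ->
    (\int[mu]_(x in A) (F eta x)%:E <= L + (C * eta)%:E * mu A)%E.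
  move=> e; have /andP[e0 _] := e.
  rewrite -addcst//.
  apply: ge0_le_integral => //.
  - by move=> x Ax; rewrite lee_fin F0.
  - by apply/measurable_EFinP; exact: mF.
  - by apply/measurable_EFinP; apply: measurable_funD.
  - move=> x Ax; rewrite lee_fin; have := FG _ _ e Ax.
    by rewrite ler_norml => /andP[_]; lra.
have lo eta : 0 < eta <= 1 ->
    (L - (C * eta)%:E * mu A <= \int[mu]_(x in A) (F eta x)%:E)%E.
  move=> e; have /andP[e0 _] := e.
  rewrite leeBlDr ?fin_numM//.
  rewrite -addcst; [|exact: e0|exact: mF|by move=> x; exact: F0].
  apply: ge0_le_integral => //.
  - exact/measurable_EFinP.
  - by apply/measurable_EFinP; apply: measurable_funD => //; exact: mF.
  - move=> x Ax; rewrite lee_fin; have := FG _ _ e Ax.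
    by rewrite ler_norml => /andP[+ _]; lra.
have mcvg (k : R) : (k * eta)%:E @[eta --> 0^'+] --> 0%:E.
  apply/fine_cvgP; split; first exact: nearW.
  rewrite -[X in _ --> X](mulr0 k); apply: cvgMr.
  exact: cvg_within.
pose m := fine (mu A).
apply: (@squeeze_cvge _ _ _ _ (fun eta => L - (C * eta)%:E * mu A)%E _
  (fun eta => L + (C * eta)%:E * mu A)%E).
- near=> eta; have e : 0 < eta <= 1.
    by apply/andP; split; near: eta; [exact: nbhs_right_gt|exact/nbhs_right_le/ltr01].
  by rewrite (lo _ e) (hi _ e).
- rewrite -[X in _ --> X]sube0; apply: cvgeB; [by rewrite fin_num_adde_defl|exact: cvg_cst|].
  under eq_fun do rewrite -(fineK muA_fin) -EFinM mulrAC.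
  exact: mcvg.
- rewrite -[X in _ --> X]adde0; apply: cvgeD; [by rewrite fin_num_adde_defl|exact: cvg_cst|].
  under eq_fun do rewrite -(fineK muA_fin) -EFinM mulrAC.
  exact: mcvg.
Unshelve. all: by end_near. Qed.

End UniformIntegral.

(** * The phase volume *)

Section PhaseVolume.
Context {R : realType}.
Local Notation space := (@Defs.space R).

Lemma measurable_sqrt : measurable_fun [set: R] (@Num.sqrt R).
Proof. by apply: continuous_measurable_fun; exact: sqrt_continuous. Qed.

Lemma measurable_dist d (T : measurableType d) (f g : T -> space) :
  measurable_fun [set: T] f -> measurable_fun [set: T] g ->
  measurable_fun [set: T] (fun x => Defs.dist (f x) (g x)).
Proof.
move=> mf mg; apply: (measurableT_comp measurable_sqrt).
apply: measurable_sum => k; apply: measurable_funX.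
by apply: measurable_funB; exact: measurable_coord.
Qed.

Lemma dist_ge0 (x y : space) : 0 <= Defs.dist x y.
Proof. exact: sqrtr_ge0. Qed.

Lemma measurable_div_dist d (T : measurableType d) (c : R) (f g : T -> space) :
  measurable_fun [set: T] f -> measurable_fun [set: T] g ->
  measurable_fun [set: T] (fun x => c / Defs.dist (f x) (g x)).
Proof.
move=> mf mg; apply: measurable_funM => //.
(* The power -1 agrees with the inverse on distances, including 0, where both are 0. *)
rewrite (_ : (fun _ => _) = (fun x => x `^ (-1)) \o
    (fun x => Defs.dist (f x) (g x))); last first.
  by apply/funext => x /=; rewrite powR_inv1// dist_ge0.
by apply: measurableT_comp; [exact: measurable_powR|exact: measurable_dist].
Qed.

Variables (N : nat) (G m : R).
Hypothesis N_gt0 : (0 < N)%N.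
Hypotheses (G_gt0 : 0 < G) (m_gt0 : 0 < m).
Local Notation vol := (@lebesgue3N R N).
Local Notation V := (@abs_potential R N G m).
Let s : R := 3 * N%:R / 2.

Lemma measurable_abs_potential : measurable_fun [set: N.-tuple space] V.
Proof.
apply: measurable_sum => i.
have -> : (fun q : N.-tuple space => \sum_(j < N | (i < j)%N)
      G * m ^+ 2 / Defs.dist (tnth q i) (tnth q j)) =
    (fun q => \sum_(j < N)
      if (i < j)%N then G * m ^+ 2 / Defs.dist (tnth q i) (tnth q j) else 0).
  by apply/funext => q; rewrite big_mkcond.
apply: measurable_sum => j; case: (i < j)%N => //.
by apply: measurable_div_dist; exact: measurable_tnth.
Qed.

Lemma abs_potential_ge0 q : 0 <= V q.
Proof.
apply: sumr_ge0 => i _; apply: sumr_ge0 => j _.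
by rewrite divr_ge0 ?dist_ge0// mulr_ge0 ?sqr_ge0// ltW.
Qed.

Lemma inertiaE (q : N.-tuple space) : inertia m q = m * normsqN q.
Proof. by rewrite /inertia /normsqN mulr_sumr. Qed.

Lemma kineticE (p : N.-tuple space) : kinetic m p = normsqN p / (2 * m).
Proof. by rewrite /kinetic /normsqN mulr_suml. Qed.

Variables (h E I U eps : R).

Definition macro_region : set (N.-tuple space) :=
  [set q | (1 - eps) * U <= V q <= (1 + eps) * U] `&`
  [set q | (1 - eps) * I <= inertia m q <= (1 + eps) * I].

Lemma measurable_preimage_itvcc d (T : measurableType d) (f : T -> R) (a b : R) :
  measurable_fun [set: T] f -> measurable [set x | a <= f x <= b].
Proof.
move=> mf; rewrite -[X in measurable X]setTI.
rewrite (_ : [set x | _] = f @^-1` `[a, b]); last first.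
  by apply/seteqP; split => q /=; rewrite in_itv.
by apply: mf => //; exact: measurable_itv.
Qed.

Lemma measurable_inertia : measurable_fun [set: N.-tuple space] (@inertia R N m).
Proof.
rewrite (_ : @inertia R N m = fun q => m * normsqN q); last exact/funext/inertiaE.
by apply: measurable_funM => //; exact: measurable_normsqN.
Qed.

Lemma measurable_macro_region : measurable macro_region.
Proof.
apply: measurableI; apply: measurable_preimage_itvcc.
  exact: measurable_abs_potential.
exact: measurable_inertia.
Qed.

Lemma vol_kinetic_shell (K eta : R) : 0 < eta ->
  vol [set p | `|kinetic m p - K| <= eta] =
  (unit_ball_volume N * (2 * m) `^ s *
    (pos_powR (K + eta) s - pos_powR (K - eta) s))%:E.
Proof.
move=> e0; have m20 : 0 < 2 * m by rewrite mulr_gt0.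
rewrite -mulrA mulrBr -!pos_powRM ?ltW// -vol_shell//; last first.
  by rewrite ler_pM2l//; lra.
congr (vol _); apply/seteqP; split => p /=;
  by rewrite kineticE ler_distl ler_pdivlMr// ler_pdivrMr// ![_ * (2 * m)]mulrC.
Qed.

Lemma measurable_delta_approx (eta : R) :
  measurable_fun [set: R] (delta_approx eta).
Proof.
apply: measurable_funM => //; apply: measurable_indic.
rewrite -[X in measurable X]setTI.
rewrite (_ : [set y | _] = @Num.norm R R @^-1` `]-oo, eta]); last first.
  by apply/seteqP; split => y /=; rewrite in_itv.
by apply: normr_measurable => //; exact: measurable_itv.
Qed.

Lemma measurable_kinetic : measurable_fun [set: N.-tuple space] (@kinetic R N m).
Proof.
rewrite (_ : @kinetic R N m = fun q => normsqN q / (2 * m)); last exact/funext/kineticE.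
by apply: measurable_funM => //; exact: measurable_normsqN.
Qed.

Lemma shell_volumeE (eta : R) : 0 < eta ->
  shell_volume N G m h E I U eps eta =
  ((N`!%:R * h ^+ (3 * N))^-1%:E *
    \int[vol]_(q in macro_region)
      (unit_ball_volume N * (2 * m) `^ s * pos_powR_quot s (E + V q) eta)%:E)%E.
Proof.
move=> e0; rewrite /shell_volume; congr (_ * _)%E.
set A1 := [set q : N.-tuple space | (1 - eps) * U <= _ <= _].
set A2 := [set q : N.-tuple space | (1 - eps) * I <= _ <= _].
have mA1 : measurable A1.
  by apply: measurable_preimage_itvcc; exact: measurable_abs_potential.
have mA2 : measurable A2.
  by apply: measurable_preimage_itvcc; exact: measurable_inertia.
pose f (z : N.-tuple space * N.-tuple space) : \bar R :=
  (delta_approx eta (hamiltonian G m z.2 z.1 - E) * \1_A1 z.2 * \1_A2 z.2)%:E.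
have mf : measurable_fun setT f.
  apply/measurable_EFinP; apply: measurable_funM; last first.
    apply: (measurableT_comp (f := \1_A2 : _ -> R)); last exact: measurable_snd.
    exact: measurable_indic.
  apply: measurable_funM; last first.
    apply: (measurableT_comp (f := \1_A1 : _ -> R)); last exact: measurable_snd.
    exact: measurable_indic.
  apply: (measurableT_comp (measurable_delta_approx eta)).
  apply: measurable_funB => //; apply: measurable_funB.
    by apply: (measurableT_comp measurable_kinetic); exact: measurable_fst.
  by apply: (measurableT_comp measurable_abs_potential); exact: measurable_snd.
have d0 y : 0 <= delta_approx eta y.
  by rewrite /delta_approx mulr_ge0 ?indicE// invr_ge0 mulr_ge0// ltW.
have f0 z : (0 <= f z)%E.
  rewrite /f lee_fin; apply: mulr_ge0; last by rewrite indicE ler0n.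
  by apply: mulr_ge0 => //; rewrite indicE ler0n.
have := fubini_tonelli (m1 := vol) (m2 := vol) f mf f0.
rewrite /f /= => ->.
rewrite [RHS]integral_mkcond; apply: eq_integral => q _.
rewrite patchE; have AE : (q \in macro_region) = (q \in A1) && (q \in A2).
  by rewrite /macro_region in_setI.
rewrite AE.
(* The indicators depend on [q] only: the momentum integral vanishes outside the macro-region and is
   the volume of a kinetic shell inside it. *)
under eq_integral do rewrite !indicE -mulrA -natrM mulnb.
case: ifPn => _; last first.
  by under eq_integral do rewrite mulr0; rewrite integral0.
under eq_integral do rewrite mulr1 /delta_approx EFinM.
have mS : measurable [set p : N.-tuple space | `|kinetic m p - (E + V q)| <= eta].
  rewrite (_ : [set p | _] = [set p | E + V q - eta <= kinetic m p <= E + V q + eta]).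
    by apply: measurable_preimage_itvcc; exact: measurable_kinetic.
  by apply/seteqP; split => p /=; rewrite ler_distl.
transitivity (\int[vol]_p ((2 * eta)^-1%:E *
   (\1_[set p : N.-tuple space | `|kinetic m p - (E + V q)| <= eta] p)%:E))%E.
  apply: eq_integral => p _; congr (_ * _%:E)%E.
  rewrite !indicE; congr (_%:R); rewrite !mem_setE.
  by rewrite /hamiltonian; congr (nat_of_bool (`|_| <= _)); ring.
rewrite ge0_integralZl//; last 2 first.
- by apply/measurable_EFinP; exact: measurable_indic.
- by rewrite lee_fin invr_ge0 mulr_ge0// ltW.
rewrite (integral_indic vol measurableT)// setIT.
apply: etrans (congr1 (fun x => ((2 * eta)^-1%:E * x)%E)
  (vol_kinetic_shell (E + V q) e0)) _.
by rewrite -EFinM /pos_powR_quot mulrCA.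
Qed.

End PhaseVolume.

(** * The limit of the smoothed volumes and its two estimates *)

Section PhaseVolumeLimit.
Context {R : realType}.
Local Notation space := (@Defs.space R).
Variables (N : nat) (G m h E I U eps : R).
Hypotheses (N_gt1 : (1 < N)%N) (G_gt0 : 0 < G) (m_gt0 : 0 < m) (h_gt0 : 0 < h).
Hypotheses (I_gt0 : 0 < I) (U_gt0 : 0 < U) (eps_gt0 : 0 < eps) (eps_lt1 : eps < 1).
Local Notation vol := (@lebesgue3N R N).
Local Notation V := (@abs_potential R N G m).
Local Notation c := (@unit_ball_volume R N).
Local Notation A := (@macro_region R N G m I U eps).
Let s : R := 3 * N%:R / 2.
Let k : R := c * (2 * m) `^ s.

Let N_gt0 : (0 < N)%N. Proof. exact: leq_trans N_gt1. Qed.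

(** Required by [pos_powR_quot_dist], which differentiates twice. *)
Let s_gt2 : 2 < s.
Proof. by rewrite /s; have : 2 <= N%:R :> R by [rewrite ler_nat]; lra. Qed.

Let s_gt0 : 0 < s. Proof. by have := s_gt2; lra. Qed.

Let c_gt0 : 0 < c. Proof. exact: unit_ball_volume_gt0. Qed.

Let k_gt0 : 0 < k. Proof. by rewrite mulr_gt0// powR_gt0// mulr_gt0. Qed.

Let integrand_ge0 x r : 0 <= k * (s * pos_powR x r).
Proof.
apply: mulr_ge0; first exact: ltW.
by apply: mulr_ge0; [exact: ltW|exact: pos_powR_ge0].
Qed.

Lemma vol_macro_region_le : (vol A <= (c * ((1 + eps) * (I / m)) `^ s)%:E)%E.
Proof.
have e0 : 0 <= (1 + eps) * (I / m) by rewrite mulr_ge0 ?divr_ge0 ?ltW// addr_gt0.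
rewrite -[X in X `^ s](max_idPl e0) -/(pos_powR _ s) -vol_ball//.
apply: le_measure; rewrite ?inE; [exact: measurable_macro_region|exact: measurable_normsqN_le|].
by move=> q [_] /=; rewrite inertiaE => /andP[_]; rewrite mulrA ler_pdivlMr// mulrC.
Qed.

Lemma measurable_pos_powR (r : R) : measurable_fun [set: R] (pos_powR ^~ r).
Proof.
apply: (measurableT_comp (measurable_powR r)).
by apply: measurable_maxr => //; exact: measurable_id.
Qed.

Let measurable_kin (x : R) : measurable_fun [set: N.-tuple space] (fun q => E + V q + x).
Proof. by do 2 apply: measurable_funD => //; exact: measurable_abs_potential. Qed.

Definition phase_integral : \bar R :=
  (\int[vol]_(q in A) (k * (s * pos_powR (E + V q) (s - 1)))%:E)%E.

Let measurable_integrand :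
  measurable_fun A (fun q => k * (s * pos_powR (E + V q) (s - 1))).
Proof.
apply: measurable_funTS; do 2 apply: measurable_funM => //.
apply: (measurableT_comp (measurable_pos_powR _)).
by apply: measurable_funD => //; exact: measurable_abs_potential.
Qed.

Lemma cvg_shell_volume :
  shell_volume N G m h E I U eps eta @[eta --> 0^'+] -->
  ((N`!%:R * h ^+ (3 * N))^-1%:E * phase_integral)%E.
Proof.
pose F eta (q : N.-tuple space) := k * pos_powR_quot s (E + V q) eta.
apply: (@cvg_trans _ ((fun eta => (N`!%:R * h ^+ (3 * N))^-1%:E *
   \int[vol]_(q in A) (F eta q)%:E)%E @ 0^'+)).
  apply: near_eq_cvg; near=> eta.
  have e0 : 0 < eta by near: eta; exact: nbhs_right_gt.
  by rewrite shell_volumeE.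
apply: cvgeZl => //.
(* On the macro-region the potential is at most [(1 + eps) * U <= 2 * U]; the absolute value of [E]
   keeps [B] nonnegative. *)
pose B : R := `|E| + 2 * U.
have B0 : 0 <= B by rewrite addr_ge0// mulr_ge0// ltW.
have VB q : A q -> E + V q <= B.
  move=> [/andP[_ VU] _]; rewrite lerD ?ler_norm//; apply: (le_trans VU).
  by rewrite ler_pM2r// -[leRHS]/(1 + 1) lerD2l ltW.
have mA : measurable A by exact: measurable_macro_region.
apply: (@cvg_integral_unif _ _ _ vol A F _
  (k * (2 * s * (s - 1) * (B + 1) `^ (s - 2))) (k * (s * pos_powR B (s - 1)))) => //.
- by apply: le_lt_trans vol_macro_region_le _; rewrite ltry.
- by rewrite mulr_ge0 ?(ltW k_gt0)// !mulr_ge0 ?powR_ge0//; have := s_gt2; lra.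
- move=> eta _; apply: measurable_funTS; apply: measurable_funM => //.
  apply: measurable_funM => //.
  by apply: measurable_funB; apply: (measurableT_comp (measurable_pos_powR _)).
- move=> eta q /andP[e0 _] _; rewrite mulr_ge0 ?(ltW k_gt0)//.
  have s1 : 1 < s by have := s_gt2; lra.
  have /andP[+ _] := pos_powR_quot_bounds (E + V q) s1 e0.
  by apply: le_trans; rewrite mulr_ge0 ?pos_powR_ge0// ltW.
- move=> q Aq; apply/andP; split.
    exact: integrand_ge0.
  rewrite ler_pM2l// ler_pM2l// le_pos_powR//; first by have := s_gt2; lra.
  exact: VB.
- move=> eta q e Aq; rewrite /F -mulrBr normrM (gtr0_norm k_gt0) -mulrA ler_pM2l//.
  by apply: pos_powR_quot_dist => //; exact: VB.
Unshelve. all: by end_near. Qed.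

Lemma phase_volumeE : phase_volume N G m h E I U eps =
  ((N`!%:R * h ^+ (3 * N))^-1%:E * phase_integral)%E.
Proof. by apply/cvg_lim => //; exact: cvg_shell_volume. Qed.

Lemma phase_integral_le : (phase_integral <=
  (k * (s * pos_powR (E + (1 + eps) * U) (s - 1)))%:E * vol A)%E.
Proof.
have mA : measurable A by exact: measurable_macro_region.
have cE r : (r%:E * vol A = \int[vol]_(q in A) (cst r%:E) q)%E by rewrite integral_cst.
rewrite cE; apply: ge0_le_integral => //.
- move=> q _; rewrite lee_fin.
  exact: integrand_ge0.
- exact/measurable_EFinP.
- move=> q [/andP[_ VU] _]; rewrite lee_fin ler_pM2l// ler_pM2l// le_pos_powR//.
    by have := s_gt2; lra.
  by rewrite lerD2l.
Qed.

Lemma phase_integral_ge :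
  ((k * (s * pos_powR (E + (1 - eps) * U) (s - 1)))%:E * vol A <= phase_integral)%E.
Proof.
have mA : measurable A by exact: measurable_macro_region.
have cE r : (r%:E * vol A = \int[vol]_(q in A) (cst r%:E) q)%E by rewrite integral_cst.
rewrite cE; apply: ge0_le_integral => //.
- move=> q _; rewrite lee_fin.
  exact: integrand_ge0.
- exact/measurable_EFinP.
- move=> q [/andP[VU _] _]; rewrite lee_fin ler_pM2l// ler_pM2l// le_pos_powR//.
    by have := s_gt2; lra.
  by rewrite lerD2l.
Qed.

Let den_gt0 : 0 < N`!%:R * h ^+ (3 * N).
Proof. by rewrite mulr_gt0 ?exprn_gt0// ltr0n fact_gt0. Qed.

(** Written with ball volumes, the estimate produces the factor [s = 3N / 2], whereas the two sphere
    areas of the prefactor provide [(3N) ^ 2 / 2]; a factor [3N] is to spare. *)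
Lemma phase_volume_le : (phase_volume N G m h E I U eps <=
  (prefactor N m h * pos_powR (E + (1 + eps) * U) (s - 1)
     * ((1 + eps) * (I / m)) `^ s)%:E)%E.
Proof.
rewrite phase_volumeE.
apply: (@le_trans _ _ ((N`!%:R * h ^+ (3 * N))^-1%:E *
   ((k * (s * pos_powR (E + (1 + eps) * U) (s - 1)))%:E *
    (c * ((1 + eps) * (I / m)) `^ s)%:E))%E).
  rewrite lee_pmul2l ?lte_fin ?invr_gt0//; apply: (le_trans phase_integral_le).
  rewrite lee_wpmul2l ?vol_macro_region_le// lee_fin.
  exact: integrand_ge0.
rewrite -!EFinM lee_fin /prefactor unit_ball_volume_sphere_area// -/s.
set P := pos_powR _ _; set Q := _ `^ s; set d := N`!%:R * h ^+ (3 * N).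
have P0 : 0 <= P by exact: powR_ge0.
have Q0 : 0 <= Q by exact: powR_ge0.
have d0 : 0 < d by exact: den_gt0.
rewrite /k; set W := (2 * m) `^ s.
have W0 : 0 <= W by exact: powR_ge0.
have X0 : 0 <= d^-1 * W * c ^+ 2 * P * Q.
  have di0 : 0 <= d^-1 by rewrite invr_ge0 ltW.
  by do 2 apply: mulr_ge0 => //; apply: mulr_ge0; [exact: mulr_ge0|exact: sqr_ge0].
have N1 : 1 <= N%:R :> R by rewrite ler1n.
have -> : d^-1 * (c * W * (s * P) * (c * Q)) = (d^-1 * W * c ^+ 2 * P * Q) * s.
  by ring.
have -> : W / (2 * N`!%:R * h ^+ (3 * N)) * (3 * N%:R * c) ^+ 2 * P * Q =
   (d^-1 * W * c ^+ 2 * P * Q) * ((3 * N%:R) ^+ 2 / 2).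
  by rewrite -[2 * N`!%:R * _]mulrA -/d; field; rewrite gt_eqF.
rewrite ler_wpM2l// /s ler_pM2r//; nra.
Qed.

(** One sphere area of the prefactor is the [2 * s * c] of the momentum integral, the other is
    supplied by the hypothesis on [vol A]; the constants then match exactly. *)
Lemma phase_volume_ge (v : R) : 0 <= v -> ((sphere_area N * v)%:E <= vol A)%E ->
  ((prefactor N m h * pos_powR (E + (1 - eps) * U) (s - 1) * v)%:E
    <= phase_volume N G m h E I U eps)%E.
Proof.
move=> v0 vA; rewrite phase_volumeE.
apply: (@le_trans _ _ ((N`!%:R * h ^+ (3 * N))^-1%:E *
   ((k * (s * pos_powR (E + (1 - eps) * U) (s - 1)))%:E *
    (sphere_area N * v)%:E))%E); last first.
  rewrite lee_pmul2l ?lte_fin ?invr_gt0//; apply: le_trans phase_integral_ge.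
  rewrite lee_wpmul2l// lee_fin.
  exact: integrand_ge0.
rewrite -!EFinM lee_fin /prefactor unit_ball_volume_sphere_area// -/s.
set P := pos_powR _ _; set d := N`!%:R * h ^+ (3 * N).
have d0 : 0 < d by exact: den_gt0.
rewrite /k; set W := (2 * m) `^ s.
rewrite le_eqVlt; apply/orP; left; apply/eqP.
by rewrite -[2 * N`!%:R * _]mulrA -/d /s; field; rewrite gt_eqF.
Qed.

End PhaseVolumeLimit.

(** * Placing the last particle *)

Section Euclid3.
Context {R : realType}.
Local Notation space := (@Defs.space R).
Implicit Types x y z : space.

Definition mkpoint (f : 'I_3 -> R) : space := mktuple f.

Lemma sqrt_sum3_triangle (a b : 'I_3 -> R) :
  Num.sqrt (\sum_(k < 3) (a k + b k) ^+ 2) <=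
  Num.sqrt (\sum_(k < 3) a k ^+ 2) + Num.sqrt (\sum_(k < 3) b k ^+ 2).
Proof.
set A := \sum_(k < 3) a k ^+ 2; set B := \sum_(k < 3) b k ^+ 2.
have A0 : 0 <= A by apply: sumr_ge0 => k _; exact: sqr_ge0.
have B0 : 0 <= B by apply: sumr_ge0 => k _; exact: sqr_ge0.
pose P := \sum_(k < 3) a k * b k.
have CS : P ^+ 2 <= A * B.
  rewrite -subr_ge0 /P /A /B !big_ord_recl !big_ord0 !addr0.
  set a0 := a _; set a1 := a _; set a2 := a _.
  set b0 := b _; set b1 := b _; set b2 := b _.
  (* Lagrange's identity. *)
  rewrite [X in 0 <= X](_ : _ = (a0 * b1 - a1 * b0) ^+ 2 +
    (a0 * b2 - a2 * b0) ^+ 2 + (a1 * b2 - a2 * b1) ^+ 2); last by ring.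
  by rewrite !addr_ge0 ?sqr_ge0.
have PAB : P <= Num.sqrt A * Num.sqrt B.
  rewrite -sqrtrM// (le_trans (ler_norm P))// -sqrtr_sqr ler_sqrt//.
  exact: mulr_ge0.
rewrite -ler_sqr ?nnegrE ?sqrtr_ge0 ?addr_ge0 ?sqrtr_ge0//.
rewrite sqr_sqrtr; last by apply: sumr_ge0 => k _; exact: sqr_ge0.
rewrite sqrrD !sqr_sqrtr//.
under eq_bigr do rewrite sqrrD.
rewrite !big_split/= -/A -/B -/P.
by rewrite lerD2r lerD2l -mulr2n ler_pMn2r.
Qed.

Lemma dist_triangle x y z : Defs.dist x z <= Defs.dist x y + Defs.dist y z.
Proof.
rewrite /Defs.dist; apply: le_trans (sqrt_sum3_triangle _ _).
rewrite le_eqVlt; apply/orP; left; apply/eqP; congr Num.sqrt.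
by apply: eq_bigr => k _; rewrite addrA subrK.
Qed.

Lemma distC x y : Defs.dist x y = Defs.dist y x.
Proof.
by congr Num.sqrt; apply: eq_bigr => k _; rewrite -sqrrN opprB.
Qed.

Lemma distxx x : Defs.dist x x = 0.
Proof.
rewrite /Defs.dist big1 ?sqrtr0// => k _.
by rewrite subrr expr0n.
Qed.

Lemma coord_le_dist x y (k : 'I_3) : `|(tnth x k : R) - tnth y k| <= Defs.dist x y.
Proof.
rewrite -sqrtr_sqr ler_wsqrtr// (bigD1 k)//= lerDl.
by apply: sumr_ge0 => j _; exact: sqr_ge0.
Qed.

(** The half-diagonal [sqrt 3 * b] is rounded up to [2 * b]. *)
Lemma cube_dist x y (b : R) : 0 <= b ->
  cube (fun k => tnth y k : R) b x -> Defs.dist x y <= 2 * b.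
Proof.
move=> b0 xb; have b20 : 0 <= 2 * b by rewrite mulr_ge0.
rewrite -(ger0_norm b20) -sqrtr_sqr.
rewrite ler_wsqrtr// (le_trans (y := \sum_(k < 3) b ^+ 2))//.
  apply: ler_sum => k _; rewrite -ler_norm_sqr//.
  by have := xb k; rewrite /= in_itv/= ler_distl.
rewrite sumr_const card_ord -subr_ge0 (_ : _ - _ = b ^+ 2) ?sqr_ge0//.
by ring.
Qed.

Lemma dist0 x : Defs.dist x (mkpoint (fun=> 0)) = Num.sqrt (normsq x).
Proof.
by congr Num.sqrt; apply: eq_bigr => k _; rewrite tnth_mktuple subr0.
Qed.

Lemma sqrt_normsq_le x y : Num.sqrt (normsq x) <= Num.sqrt (normsq y) + Defs.dist x y.
Proof. by rewrite -!dist0 addrC dist_triangle. Qed.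

Definition segment x y (t : R) : space :=
  mkpoint (fun k => (1 - t) * (tnth x k : R) + t * (tnth y k : R)).

Lemma segment0 x y : segment x y 0 = x.
Proof.
by apply: eq_from_tnth => k; rewrite tnth_mktuple subr0 mul1r mul0r addr0.
Qed.

Lemma segment1 x y : segment x y 1 = y.
Proof.
by apply: eq_from_tnth => k; rewrite tnth_mktuple subrr mul1r mul0r add0r.
Qed.

Lemma normsq_segment x y (t r : R) : 0 <= t <= 1 ->
  normsq x <= r -> normsq y <= r -> normsq (segment x y t) <= r.
Proof.
move=> /andP[t0 t1] xr yr.
apply: (@le_trans _ _ ((1 - t) * normsq x + t * normsq y)).
  rewrite /normsq !mulr_sumr -big_split/=; apply: ler_sum => k _.
  rewrite tnth_mktuple -subr_ge0; set u := (tnth x k : R); set v := (tnth y k : R).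
  rewrite [X in 0 <= X](_ : _ = t * (1 - t) * (u - v) ^+ 2); last by ring.
  by apply: mulr_ge0 (sqr_ge0 _); rewrite mulr_ge0// subr_ge0.
have h1 : (1 - t) * normsq x <= (1 - t) * r by rewrite ler_wpM2l// subr_ge0.
have h2 : t * normsq y <= t * r by rewrite ler_wpM2l.
lra.
Qed.

Lemma continuous_sumR (T : topologicalType) (J : Type) (r : seq J)
    (F : J -> T -> R) : (forall i, continuous (F i)) ->
  continuous (fun u => \sum_(i <- r) F i u).
Proof.
by move=> cF; apply: continuous_big => [|i _]; [exact: add_continuous|exact: cF].
Qed.

Lemma continuous_dist_segment x y z : continuous (fun t => Defs.dist (segment x y t) z).
Proof.
have cs : continuous (fun t : R =>
    \sum_(k < 3) ((tnth (segment x y t) k : R) - tnth z k) ^+ 2).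
  apply: continuous_sumR => k t.
  apply: differentiable_continuous; apply/derivable1_diffP.
  rewrite (_ : (fun _ => _) = fun t : R =>
    ((1 - t) * (tnth x k : R) + t * (tnth y k : R) - (tnth z k : R)) ^+ 2); last first.
    by apply/funext => u; rewrite tnth_mktuple.
  exact: ex_derive.
by move=> t; apply: continuous_comp; [exact: cs|exact: sqrt_continuous].
Qed.

End Euclid3.

(** * Placing one more particle so that the total potential is [U] *)

Section Placement.
Context {R : realType}.
Local Notation space := (@Defs.space R).
Variables (M : nat) (g rho U eps : R) (q : M.-tuple space).
Hypotheses (M_gt0 : (0 < M)%N) (g_gt0 : 0 < g) (rho_gt0 : 0 < rho) (U_gt0 : 0 < U).

Definition site_potential (x : space) : R :=
  \sum_(j < M) g / Defs.dist x (tnth q j).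

Let M0 : 0 < M%:R :> R. Proof. by rewrite ltr0n. Qed.

(* Of the M + 1 equally spaced points on a diameter, each particle is close to at most one. *)
Lemma exists_far_point : exists x : space, normsq x <= rho ^+ 2 /\
  forall j, rho / M%:R <= Defs.dist x (tnth q j).
Proof.
pose pt (i : 'I_M.+1) : space :=
  mkpoint (fun k => if k == ord0 then rho * (2 * i%:R / M%:R - 1) else 0).
suff [i hi] : exists i, forall j, rho / M%:R <= Defs.dist (pt i) (tnth q j).
  exists (pt i); split => //.
  rewrite /normsq !big_ord_recl big_ord0 !tnth_mktuple/= expr0n !addr0 exprMn.
  rewrite ler_piMr ?sqr_ge0// -[leRHS](expr1n R 2) -ler_norm_sqr// ler_norml.
  have : i%:R <= M%:R :> R by rewrite ler_nat -ltnS.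
  have i0 : 0 <= i%:R :> R by [].
  move=> iM; have : 0 <= i%:R / M%:R :> R by rewrite divr_ge0.
  have : i%:R / M%:R <= 1 :> R by rewrite ler_pdivrMr// mul1r.
  by move=> ? ?; apply/andP; split; rewrite -mulrA; lra.
apply: contrapT => /forallNP h.
have {h}h i : exists j, Defs.dist (pt i) (tnth q j) < rho / M%:R.
  by have /existsNP[j /negP] := h i; rewrite -ltNge; exists j.
pose f i := sval (cid (h i)).
have hf i : Defs.dist (pt i) (tnth q (f i)) < rho / M%:R by rewrite /f; case: cid.
(* Two points close to the same particle would be less than [2 * rho / M] apart, which is the
   spacing of the points. Injectivity then contradicts the count of [M + 1] points against [M]
   particles. *)
have : injective f.
  move=> i i' e.
  have d : Defs.dist (pt i) (pt i') < 2 * (rho / M%:R).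
    apply: le_lt_trans (dist_triangle _ (tnth q (f i)) _) _.
    by rewrite mulr_natl mulr2n ltrD ?hf// distC e hf.
  have := le_lt_trans (coord_le_dist (pt i) (pt i') ord0) d.
  rewrite !tnth_mktuple/= (_ : _ - _ = (2 * (rho / M%:R)) * (i%:R - i'%:R)); last first.
    by field; rewrite gt_eqF.
  have p0 : 0 < 2 * (rho / M%:R) by rewrite mulr_gt0// divr_gt0.
  rewrite normrM (gtr0_norm p0) gtr_pMr// => dd.
  apply/val_inj => /=; move: dd; rewrite ltr_norml => /andP[d1 d2].
  case: (ltngtP i i') => // ii'.
    have : i.+1%:R <= i'%:R :> R by rewrite ler_nat.
    by rewrite -natr1 => d3; exfalso; clear e; lra.
  have : i'.+1%:R <= i%:R :> R by rewrite ler_nat.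
  by rewrite -natr1 => d3; exfalso; clear e; lra.
move=> /leq_card; rewrite !card_ord ltnn //.
Qed.

Let W := site_potential.

(** Because [1 / 0 = 0], the potential is not continuous at collisions, so the intermediate value
    theorem is applied to a potential with distances truncated below at [delta]. At the point found,
    the truncation turns out to be inactive. The path is a segment with both ends in the ball of
    radius [rho], hence stays in it. *)
Lemma exists_site (Vq : R) : 0 <= Vq -> normsqN q <= M%:R * rho ^+ 2 ->
  M%:R ^+ 2 * g / rho + Vq <= U ->
  exists x : space, [/\ normsq x <= rho ^+ 2, W x + Vq = U &
    forall j, g / U <= Defs.dist x (tnth q j)].
Proof.
move=> Vq0 qrho VU.
have [x0 [x0rho x0far]] := exists_far_point.
(* Averaging: the [M] squared norms sum to at most [M * rho ^+ 2]. *)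
have [i irho] : exists i, normsq (tnth q i) <= rho ^+ 2.
  apply: contrapT => /forallNP h; move: qrho; apply/negP; rewrite -ltNge.
  rewrite mulr_natl -[X in _ *+ X](card_ord M) -sumr_const.
  apply: ltr_sum; first by apply/hasP; exists (Ordinal M_gt0); rewrite ?mem_index_enum.
  by move=> j _; rewrite ltNge; apply/negP/h.
(* A collision then contributes [2 * U], enough to exceed [U], while a total of at most [U] forces
   every truncated distance to be at least [g / U > delta]. *)
pose delta := g / (2 * U).
have delta0 : 0 < delta by rewrite divr_gt0// mulr_gt0.
pose phi t := \sum_(j < M) g / Num.max (Defs.dist (segment x0 (tnth q i) t) (tnth q j)) delta.
have max0 t j : 0 < Num.max (Defs.dist (segment x0 (tnth q i) t) (tnth q j)) delta.
  by rewrite lt_max delta0 orbT.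
have cphi : continuous phi.
  apply: continuous_sumR => j t; apply: cvgM; first exact: cvg_cst.
  apply: cvgV; first by rewrite gt_eqF.
  apply: (@continuous_max R _ (fun t => Defs.dist (segment x0 (tnth q i) t) (tnth q j)) (fun=> delta)).
    exact: continuous_dist_segment.
  exact: cst_continuous.
have phi0 : phi 0 <= U - Vq.
  rewrite lerBrDr (le_trans _ VU)// lerD2r /phi segment0.
  apply: (@le_trans _ _ (\sum_(j < M) g / (rho / M%:R))).
    apply: ler_sum => j _; rewrite ler_pM2l// lef_pV2 ?posrE ?divr_gt0//; last first.
      by rewrite lt_max delta0 orbT.
    by rewrite le_max x0far.
  rewrite sumr_const card_ord -mulr_natl le_eqVlt; apply/orP; left; apply/eqP.
  by field; rewrite !gt_eqF.
have phi1 : U <= phi 1.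
  rewrite /phi segment1 (bigD1 i)//= distxx (max_idPr (ltW delta0)).
  have : 0 <= \sum_(j < M | j != i) g / Num.max (Defs.dist (tnth q i) (tnth q j)) delta.
    by apply: sumr_ge0 => j _; rewrite divr_ge0 ?(ltW g_gt0)// le_max (ltW delta0) orbT.
  have -> : g / delta = 2 * U by rewrite /delta; field; rewrite !gt_eqF.
  by have := U_gt0; lra.
have [||t] := @IVT R phi 0 1 (U - Vq) ler01.
- exact: continuous_subspaceT.
- by rewrite ge_min phi0/= le_max; apply/orP; right; lra.
rewrite in_itv/= => /andP[t0 t1] phit.
exists (segment x0 (tnth q i) t).
have far j : g / U <= Num.max (Defs.dist (segment x0 (tnth q i) t) (tnth q j)) delta.
  rewrite ler_pdivrMr// mulrC -ler_pdivrMr//.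
  apply: (@le_trans _ _ (phi t)); last by rewrite phit; lra.
  rewrite /phi (bigD1 j)//= lerDl; apply: sumr_ge0 => k _.
  by rewrite divr_ge0 ?(ltW g_gt0)// ltW.
have far' j : g / U <= Defs.dist (segment x0 (tnth q i) t) (tnth q j).
  have := far j; rewrite le_max => /orP[//|].
  rewrite /delta => h; exfalso; move: h; apply/negP; rewrite -ltNge.
  rewrite ltr_pM2l// ltf_pV2 ?posrE ?mulr_gt0//.
  by have := U_gt0; lra.
split => //.
- by apply: normsq_segment; rewrite // t0 t1.
- rewrite -[RHS](subrK Vq) -phit; congr (_ + _).
  apply: eq_bigr => j _; congr (_ / _); apply/esym/max_idPl.
  apply: le_trans (far' j); rewrite /delta ler_pM2l// lef_pV2 ?posrE ?mulr_gt0//.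
  by have := U_gt0; lra.
Qed.

(** The displacement is at most [eps / 2] times each distance [d], so each distance changes by a
    factor in [[1 - eps / 2, 1 + eps / 2]]; then [(1 - eps) * (1 + eps / 2) <= 1 <= (1 + eps) * (1 -
    eps / 2)] controls the inverses. The fixed part [Vq >= 0] only widens the admissible window. *)
Lemma site_window (Vq : R) (x y : space) : 0 <= Vq -> 0 < eps < 1 ->
  W x + Vq = U -> (forall j, g / U <= Defs.dist x (tnth q j)) ->
  Defs.dist y x <= eps * g / (2 * U) ->
  (1 - eps) * U <= W y + Vq <= (1 + eps) * U.
Proof.
move=> Vq0 /andP[e0 e1] WU far yx.
have key j : (1 - eps) * (g / Defs.dist x (tnth q j)) <= g / Defs.dist y (tnth q j)
    <= (1 + eps) * (g / Defs.dist x (tnth q j)).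
  have d1 := dist_triangle y x (tnth q j).
  have d2 := dist_triangle x y (tnth q j).
  rewrite (distC x y) in d2.
  have := far j; move: d1 d2; set d := Defs.dist x _; set d' := Defs.dist y _.
  move=> d1 d2 dU.
  have gU : 0 < g / U by rewrite divr_gt0.
  have d0 : 0 < d by exact: lt_le_trans dU.
  have r2 : Defs.dist y x <= eps / 2 * d.
    apply: (le_trans yx); rewrite (_ : _ / _ = eps / 2 * (g / U)).
      by rewrite ler_pM2l// divr_gt0.
    by field; rewrite gt_eqF.
  have lo : (1 - eps / 2) * d <= d' by lra.
  have hi : d' <= (1 + eps / 2) * d by lra.
  have d'0 : 0 < d' by apply: lt_le_trans lo; rewrite mulr_gt0//; lra.
  have ed : 0 < eps * d by rewrite mulr_gt0.
  rewrite ler_pdivlMr// ler_pdivrMr//.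
  rewrite (_ : (1 - eps) * (g / d) * d' = g * ((1 - eps) * (d' / d))); last first.
    by field; rewrite gt_eqF.
  rewrite (_ : (1 + eps) * (g / d) * d' = g * ((1 + eps) * (d' / d))); last first.
    by field; rewrite gt_eqF.
  have lo' : 1 - eps / 2 <= d' / d by rewrite ler_pdivlMr.
  have hi' : d' / d <= 1 + eps / 2 by rewrite ler_pdivrMr.
  apply/andP; split.
    rewrite ler_piMr ?(ltW g_gt0)//.
    apply: (@le_trans _ _ ((1 - eps) * (1 + eps / 2))); last by nra.
    by rewrite ler_wpM2l//; lra.
  rewrite ler_peMr ?(ltW g_gt0)//.
  apply: (@le_trans _ _ ((1 + eps) * (1 - eps / 2))); first by nra.
  by rewrite ler_wpM2l//; lra.
have lo : (1 - eps) * W x <= W y.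
  by rewrite /W /site_potential mulr_sumr; apply: ler_sum => j _; have /andP[] := key j.
have hi : W y <= (1 + eps) * W x.
  by rewrite /W /site_potential mulr_sumr; apply: ler_sum => j _; have /andP[] := key j.
have eV : 0 <= eps * Vq by rewrite mulr_ge0// ltW.
rewrite -WU !mulrDr !mulrDl !mul1r; move: lo hi; rewrite mulrBl mulrDl !mul1r mulNr => lo hi.
by apply/andP; split; lra.
Qed.

End Placement.

(** * Typical configurations *)

Section MeanPotential.
Context {R : realType}.
Local Notation space := (@Defs.space R).
Local Notation RR := (measurableTypeR R).
Local Notation vol3 := (@lebesgue3 R).

(** Raising the truncation level from [2 ^+ k / a] to its double adds at most [2 ^+ k / a], and only
    where [u] exceeds the lower level. This discrete layer cake takes the place of polar
    coordinates. *)
Lemma le_dyadic_sum (u a : R) n : 0 < a -> 0 <= u ->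
  Num.min u (2 ^+ n / a) <=
  a^-1 + \sum_(k < n) 2 ^+ k / a * (2 ^+ k / a < u)%R%:R.
Proof.
move=> a0 u0; elim: n => [|n ih].
  by rewrite big_ord0 addr0 expr0 mul1r ge_min lexx orbT.
rewrite big_ord_recr/= addrA; set S := _ + \sum_(_ < _) _ in ih *.
have p0 : 0 <= 2 ^+ n / a by rewrite divr_ge0 ?exprn_ge0 ?ltW.
rewrite exprS -mulrA; set p := 2 ^+ n / a in ih p0 *.
case: ltP => pu; last first.
  by rewrite mulr0 addr0 (le_trans _ ih)// ge_min le_min lexx pu.
move: ih; rewrite (min_idPr (ltW pu)) mulr1 => ih.
rewrite ge_min; apply/orP; right; lra.
Qed.

Lemma dist_lt_cube (x y : space) (b : R) : Defs.dist x y < b ->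
  cube (fun k => tnth y k : R) b x.
Proof.
move=> xb k /=; rewrite in_itv/= -ler_distl; apply: le_trans (ltW xb).
exact: coord_le_dist.
Qed.

(** The level [a^-1] contributes [8 * a ^+ 2]. The set where [1 / dist > 2 ^+ k / a] lies in a cube
    of half-side [a / 2 ^+ k] about [y] and contributes at most [8 * a ^+ 2 / 4 ^+ k]; the geometric
    series gives 32/3, and 8 + 32/3 = 56/3. *)
Lemma integral_inv_dist_cube (a : R) (y : space) : 0 < a ->
  (\int[vol3]_(x in cube (fun=> 0%R) a) (1 / Defs.dist x y)%:E
    <= (56 / 3 * a ^+ 2)%:E)%E.
Proof.
move=> a0.
set Q : set space := cube _ a.
have mQ : measurable Q by exact: measurable_cube.
have mu : measurable_fun [set: space] (fun x => 1 / Defs.dist x y).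
  by apply: measurable_div_dist => //; exact: measurable_id.
have u0 (x : space) : 0 <= 1 / Defs.dist x y by rewrite divr_ge0 ?dist_ge0.
pose B k := [set x : space | 2 ^+ k / a < 1 / Defs.dist x y].
have mB k : measurable (B k).
  rewrite -[X in measurable X]setTI.
  rewrite (_ : B k = (fun x => 1 / Defs.dist x y) @^-1` `]2 ^+ k / a, +oo[); last first.
    by apply/seteqP; split => x /=; rewrite in_itv/= andbT.
  by apply: mu => //; exact: measurable_itv.
have p0 k : 0 < 2 ^+ k / a by rewrite divr_gt0 ?exprn_gt0.
have volB k : (vol3 (B k) <= ((2 * (a / 2 ^+ k)) ^+ 3)%:E)%E.
  rewrite -(@lebesgue3_cube R (fun i => tnth y i : R)); last first.
    by rewrite divr_ge0 ?exprn_ge0 ?ltW.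
  apply: le_measure; rewrite ?inE; [exact: mB|exact: measurable_cube|].
  move=> x /= xB; apply: dist_lt_cube; rewrite -invf_div.
  (* At distance 0 the quotient is 0 by convention, so [y] itself is not in [B k]. *)
  have d0 : 0 < Defs.dist x y.
    rewrite lt_neqAle dist_ge0 andbT; apply/eqP => d0; move: xB.
    by rewrite /B/= -d0 invr0 mulr0 ltNge (ltW (p0 k)).
  by rewrite -[X in X < _]invrK ltf_pV2 ?posrE ?invr_gt0// -[X in _ < X]mul1r.
pose f k (x : space) : \bar R := (2 ^+ k / a * \1_(B k) x)%:E.
have mf k : measurable_fun Q (f k).
  by apply/measurable_EFinP; apply: measurable_funTS; apply: measurable_funM.
have f0 k x : (0 <= f k x)%E.
  by rewrite lee_fin mulr_ge0 ?(ltW (p0 k))// indicE ler0n.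
have If k : (\int[vol3]_(x in Q) f k x <= (8 * a ^+ 2 * 4^-1 ^+ k)%:E)%E.
  under eq_integral do rewrite /f EFinM.
  have pe0 : (0 <= (2 ^+ k / a)%:E)%E by rewrite lee_fin ltW.
  rewrite ge0_integralZl//; last first.
    by apply/measurable_EFinP; apply: measurable_funTS; exact: measurable_indic.
  rewrite integral_indic//.
  apply: (@le_trans _ _ ((2 ^+ k / a)%:E * ((2 * (a / 2 ^+ k)) ^+ 3)%:E)%E).
    rewrite lee_wpmul2l//; apply: le_trans (volB k).
    apply: le_measure; rewrite ?inE.
    - by apply: measurableI; [exact: mB|exact: mQ].
    - exact: mB.
    - by move=> x [].
  rewrite -EFinM lee_fin le_eqVlt; apply/orP; left; apply/eqP.
  rewrite (_ : 4^-1 ^+ k = (2 ^+ k)^-1 ^+ 2); last first.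
    by rewrite -exprVn exprAC; congr (_ ^+ k); field.
  by field; rewrite gt_eqF//= gt_eqF// exprn_gt0.
have sum4 n : \sum_(0 <= k < n) (8 * a ^+ 2 * 4^-1 ^+ k) <= 32 / 3 * a ^+ 2.
  suff -> : \sum_(0 <= k < n) (8 * a ^+ 2 * 4^-1 ^+ k) =
      32 / 3 * a ^+ 2 * (1 - 4^-1 ^+ n).
    apply: ler_piMr; first by apply: mulr_ge0; rewrite ?sqr_ge0.
    by rewrite gerBl exprn_ge0.
  elim: n => [|n ih]; first by rewrite big_geq// expr0 subrr mulr0.
  rewrite big_nat_recr//= ih [4^-1 ^+ n.+1]exprS; set e := 4^-1 ^+ n.
  by field.
apply: (@le_trans _ _ (\int[vol3]_(x in Q) ((a^-1)%:E + \sum_(0 <= k <oo) f k x))%E).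
  apply: ge0_le_integral => //.
  - by move=> x _; rewrite lee_fin u0.
  - by apply/measurable_EFinP; exact: measurable_funTS.
  - apply: emeasurable_funD => //; exact: ge0_emeasurable_sum.
  - move=> x _; set u := 1 / _.
    have [n un] : exists n, u <= 2 ^+ n / a.
      exists (Num.bound (u * a)); rewrite ler_pdivlMr// (le_trans (ltW (archi_boundP _)))//.
        by apply: mulr_ge0; [exact: u0|exact: ltW].
      by rewrite -natrX ler_nat ltnW// ltn_expl.
    apply: (@le_trans _ _ ((a^-1)%:E + \sum_(0 <= k < n) f k x)%E); last first.
      by rewrite leeD2l//; apply: nneseries_lim_ge => k _ _.
    rewrite sumEFin -EFinD lee_fin.
    have := le_dyadic_sum n a0 (u0 x); rewrite -/u (min_idPl un) => /le_trans; apply.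
    rewrite lerD2l big_mkord; apply: ler_sum => k _.
    rewrite indicE ler_wpM2l ?(ltW (p0 k))// ler_nat.
    case: ltP => //= uk; rewrite mem_set//.
rewrite ge0_integralD//; last 3 first.
- by move=> x _; rewrite lee_fin invr_ge0 ltW.
- by move=> x _; exact: nneseries_ge0.
- exact: ge0_emeasurable_sum.
have -> : (\int[vol3]_(x in Q) (a^-1)%:E = (a^-1)%:E * ((2 * a) ^+ 3)%:E)%E.
  apply: etrans (integral_cst vol3 mQ _) _; congr (_ * _)%E.
  by apply: lebesgue3_cube; exact: ltW.
rewrite integral_nneseries//.
apply: (@le_trans _ _ ((a^-1)%:E * ((2 * a) ^+ 3)%:E + (32 / 3 * a ^+ 2)%:E)%E).
  rewrite leeD2l//; apply: lime_le.
    by apply: is_cvg_nneseries => k _ _; apply: integral_ge0.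
  apply: nearW => n; apply: le_trans (_ : (\sum_(0 <= k < n) (8 * a ^+ 2 * 4^-1 ^+ k)%:E <= _)%E).
    by apply: lee_sum => k _.
  by rewrite sumEFin lee_fin.
rewrite -EFinM -EFinD lee_fin le_eqVlt; apply/orP; left; apply/eqP.
by field; rewrite gt_eqF.
Qed.

End MeanPotential.

Section TypicalConfigurations.
Context {R : realType}.
Local Notation space := (@Defs.space R).
Local Notation RR := (measurableTypeR R).
Local Notation vol3 := (@lebesgue3 R).
Variables (G m : R).
Hypotheses (G_gt0 : 0 < G) (m_gt0 : 0 < m).
Local Notation g := (G * m ^+ 2).
Local Notation V := (abs_potential G m).

Let g_gt0 : 0 < g. Proof. by rewrite mulr_gt0// exprn_gt0. Qed.

Lemma tnth_tcons0 n (x : space) (q : n.-tuple space) : tnth (tcons (x, q)) ord0 = x.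
Proof. by []. Qed.

Lemma tnth_tconsS n (x : space) (q : n.-tuple space) i :
  tnth (tcons (x, q)) (lift ord0 i) = tnth q i.
Proof. by rewrite tnthS. Qed.

Lemma normsqN_tcons n (x : space) (q : n.-tuple space) :
  normsqN (tcons (x, q)) = normsq x + normsqN q.
Proof.
rewrite /normsqN big_ord_recl tnth_tcons0; congr (_ + _).
by apply: eq_bigr => i _; rewrite tnth_tconsS.
Qed.

Lemma abs_potential_tcons n (x : space) (q : n.-tuple space) :
  V (tcons (x, q)) = site_potential g q x + V q.
Proof.
rewrite /abs_potential big_ord_recl; congr (_ + _).
  rewrite big_mkcond big_ord_recl/= add0r; apply: eq_bigr => j _.
  by rewrite tnth_tcons0 tnth_tconsS.
apply: eq_bigr => i _; rewrite big_mkcond big_ord_recl/= add0r -big_mkcond/=.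
by apply: eq_big => [j|j _]; rewrite ?lift0 ?ltnS// !tnth_tconsS.
Qed.

Lemma cubeN_tcons n (b : R) (x : space) (q : n.-tuple space) :
  (tcons (x, q) \in cubeN b) = (x \in cube (fun=> 0) b) && (q \in cubeN b).
Proof.
apply/idP/andP; rewrite !inE.
  move=> h; split; first by have := h ord0; rewrite tnth_tcons0.
  by move=> i; have := h (lift ord0 i); rewrite tnth_tconsS.
by move=> [h0 h] i; case: (unliftP ord0 i) => [j|] ->; rewrite ?tnth_tconsS.
Qed.

Lemma integral_site_potential_cube n (a : R) (q : n.-tuple space) : 0 < a ->
  (\int[vol3]_(x in cube (fun=> 0%R) a) (site_potential g q x)%:E
    <= (n%:R * (g * (56 / 3 * a ^+ 2)))%:E)%E.
Proof.
move=> a0; rewrite /site_potential.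
have mu (j : 'I_n) : measurable_fun [set: space] (fun x => g / Defs.dist x (tnth q j)).
  by apply: measurable_div_dist => //; exact: measurable_id.
have u0 (j : 'I_n) (x : space) : 0 <= g / Defs.dist x (tnth q j).
  by rewrite divr_ge0 ?dist_ge0// ltW.
under eq_integral do rewrite -sumEFin.
rewrite ge0_integral_sum//; last 3 first.
- exact: measurable_cube.
- by move=> j; apply/measurable_EFinP; exact: measurable_funTS.
- by move=> j x _; rewrite lee_fin.
apply: (@le_trans _ _ (\sum_(j < n) (g * (56 / 3 * a ^+ 2))%:E)%E).
  apply: lee_sum => j _; rewrite EFinM.
  apply: le_trans (lee_wpmul2l _ (integral_inv_dist_cube (tnth q j) a0)); last first.
    by rewrite lee_fin ltW.
  rewrite -ge0_integralZl//; last 4 first.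
  - exact: measurable_cube.
  - apply/measurable_EFinP; apply: measurable_funTS.
    by apply: measurable_div_dist => //; exact: measurable_id.
  - by move=> x _; rewrite lee_fin divr_ge0 ?dist_ge0.
  - by rewrite lee_fin ltW.
  by under [leRHS]eq_integral do rewrite -EFinM mulrA mulr1.
by rewrite sumEFin sumr_const card_ord [n%:R * _]mulr_natl.
Qed.

(** There are [n * (n - 1) / 2] pairs, and each has mean at most [g * (56 / 3 * a ^+ 2) / (8 * a ^+
    3) = g * 7 / (3 * a)] over the cube. *)
Lemma integral_abs_potential_cubeN n (a : R) : 0 < a ->
  (\int[lebesgue3N n]_(q in cubeN a) (V q)%:E <=
    ((8 * a ^+ 3) ^+ n * (g * (7 / (3 * a)) * (n%:R * (n%:R - 1) / 2)))%:E)%E.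
Proof.
move=> a0; elim: n => [|n ih].
  rewrite (_ : (fun _ => _) = cst 0%E); last first.
    by apply/funext => q; rewrite /abs_potential big_ord0.
  by rewrite integral0 mul0r mul0r !mulr0.
have mV k : measurable_fun [set: k.-tuple space] (fun q => (V q)%:E).
  by apply/measurable_EFinP; exact: measurable_abs_potential.
have V0 k (q : k.-tuple space) : (0 <= (V q)%:E)%E by rewrite lee_fin abs_potential_ge0.
rewrite integral_mkcond integral_tupleSr; last 2 first.
- by apply/(measurable_restrictT _ (measurable_cubeN _)); exact: (measurable_funTS (mV _)).
- by move=> q; rewrite patchE; case: ifP.
set K := g * (56 / 3 * a ^+ 2).
have K0 : 0 <= K by rewrite mulr_ge0 ?(ltW g_gt0)// mulr_ge0 ?sqr_ge0.
apply: (@le_trans _ _ (\int[lebesgue3N n]_(q in cubeN a)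
   ((n%:R * K)%:E + ((2 * a) ^+ 3)%:E * (V q)%:E))%E).
  rewrite [leRHS]integral_mkcond; apply: ge0_le_integral => //.
  - move=> q _; apply: integral_ge0 => x _.
    by rewrite patchE; case: ifP.
  - apply: measurable_integral_tconsr.
      by apply/(measurable_restrictT _ (measurable_cubeN _)); exact: (measurable_funTS (mV _)).
    by move=> q; rewrite patchE; case: ifP.
  - apply/(measurable_restrictT _ (measurable_cubeN _)); apply: measurable_funTS.
    apply: emeasurable_funD; first exact: measurable_cst.
    by apply: emeasurable_funM; [exact: measurable_cst|exact: mV].
  - move=> q _; rewrite patchE; under eq_integral do rewrite patchE cubeN_tcons.
    case: ifPn => qa; last first.
      by under eq_integral do rewrite andbF; rewrite integral0.
    under eq_integral do rewrite andbT.
    rewrite (_ : (fun x => _) = (fun x => (site_potential g q x + V q)%:E) \_ (cube (fun=> 0) a)); last first.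
      by apply/funext => x; rewrite patchE abs_potential_tcons.
    rewrite -integral_mkcond.
    under eq_integral do rewrite EFinD.
    rewrite ge0_integralD//; last 3 first.
    + exact: measurable_cube.
    + move=> x _; rewrite lee_fin; apply: sumr_ge0 => j _.
      by rewrite divr_ge0 ?dist_ge0// ltW.
    + apply/measurable_EFinP; apply: measurable_funTS; apply: measurable_sum => j.
      by apply: measurable_div_dist => //; exact: measurable_id.
    apply: leeD; first exact: integral_site_potential_cube.
    have -> : (\int[vol3]_(x in cube (fun=> 0%R) a) (V q)%:E =
       (V q)%:E * ((2 * a) ^+ 3)%:E)%E.
      apply: etrans (integral_cst vol3 (measurable_cube _ _) _) _; congr (_ * _)%E.
      by apply: lebesgue3_cube; exact: ltW.
    by rewrite muleC.
rewrite ge0_integralD//; last 4 first.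
- exact: measurable_cubeN.
- by move=> q _; rewrite lee_fin mulr_ge0.
- by move=> q _; rewrite mule_ge0// lee_fin exprn_ge0// mulr_ge0// ltW.
- apply: measurable_funTS; apply: emeasurable_funM; first exact: measurable_cst.
  exact: mV.
rewrite ge0_integralZl//; last 3 first.
- exact: measurable_cubeN.
- exact: (measurable_funTS (mV _)).
- by rewrite lee_fin exprn_ge0// mulr_ge0// ltW.
have -> : (\int[lebesgue3N n]_(x in cubeN a) (n%:R * K)%:E =
    (n%:R * K)%:E * ((2 * a) ^+ (3 * n))%:E)%E.
  apply: etrans (integral_cst (lebesgue3N n) (measurable_cubeN _) _) _; congr (_ * _)%E.
  by apply: lebesgue3N_cubeN; exact: ltW.
have a3 : (2 * a) ^+ 3 = 8 * a ^+ 3 by ring.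
apply: (@le_trans _ _ ((n%:R * K)%:E * ((2 * a) ^+ (3 * n))%:E + ((2 * a) ^+ 3)%:E *
  ((8 * a ^+ 3) ^+ n * (g * (7 / (3 * a)) * (n%:R * (n%:R - 1) / 2)))%:E)%E).
  by rewrite leeD2l// lee_wpmul2l// lee_fin exprn_ge0// mulr_ge0// ltW.
rewrite -!EFinM -EFinD lee_fin exprM a3 [_ ^+ n.+1]exprS /K -[n.+1%:R]natr1.
set X := (8 * a ^+ 3) ^+ n.
rewrite le_eqVlt; apply/orP; left; apply/eqP.
by field; rewrite gt_eqF.
Qed.

End TypicalConfigurations.

(** * A thin shell of configurations with low potential *)

Section TypicalShell.
Context {R : realType}.
Local Notation space := (@Defs.space R).
Variables (G m : R) (M : nat) (rho : R).
Hypotheses (G_gt0 : 0 < G) (m_gt0 : 0 < m) (M_gt0 : (0 < M)%N) (rho_gt0 : 0 < rho).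
Local Notation g := (G * m ^+ 2).
Local Notation V := (@abs_potential R M G m).
Local Notation vol := (@lebesgue3N R M).

Let g_gt0 : 0 < g. Proof. by rewrite mulr_gt0// exprn_gt0. Qed.
Let M0 : 0 < M%:R :> R. Proof. by rewrite ltr0n. Qed.

(* [3 a^2 <= rho^2], so the cube lies in the ball [normsqN q <= M rho^2]; [v] exceeds the
   mean of the potential on the cube, at most [49/24 M^2 g / rho]. *)
Let a := 4 / 7 * rho.
Let v := 5 / 2 * M%:R ^+ 2 * g / rho.
Let a_gt0 : 0 < a. Proof. by rewrite mulr_gt0// divr_gt0. Qed.
Let v_gt0 : 0 < v. Proof. by rewrite divr_gt0// !mulr_gt0 ?divr_gt0 ?exprn_gt0. Qed.

Lemma measurable_abs_potential_le (t : R) : measurable [set q | V q <= t].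
Proof.
rewrite -[X in measurable X]setTI.
rewrite (_ : [set q | _] = V @^-1` `]-oo, t]); last first.
  by apply/seteqP; split => q /=; rewrite in_itv.
by apply: measurable_abs_potential => //; exact: measurable_itv.
Qed.

Lemma vol_low_potential_cube :
  (((8 * a ^+ 3) ^+ M / 8)%:E <= vol (cubeN a `&` [set q | (V q <= v)%R]))%E.
Proof.
set X := (8 * a ^+ 3) ^+ M.
have X0 : 0 < X by rewrite exprn_gt0// mulr_gt0// exprn_gt0.
have mQ : measurable (@cubeN R M a) by exact: measurable_cubeN.
have mL := measurable_abs_potential_le v.
have volQ : vol (cubeN a) = X%:E.
  rewrite lebesgue3N_cubeN; last exact: ltW.
  by rewrite exprM /X; congr ((_ ^+ _)%:E); ring.
set A := cubeN a `&` _; pose B := cubeN a `\` [set q | V q <= v].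
have mA : measurable A by exact: measurableI.
have mB : measurable B by exact: measurableD.
have QE : vol (cubeN a) = (vol B + vol A)%E by exact: measureDI.
have B0 : (0 <= vol B)%E by exact: measure_ge0.
have A0 : (0 <= vol A)%E by exact: measure_ge0.
have mV : measurable_fun [set: M.-tuple space] (fun q => (V q)%:E).
  by apply/measurable_EFinP; exact: measurable_abs_potential.
have markov : (v%:E * vol B <=
    (X * (g * (7 / (3 * a)) * (M%:R * (M%:R - 1) / 2)))%:E)%E.
  apply: le_trans (integral_abs_potential_cubeN G_gt0 m_gt0 M a_gt0).
  apply: (@le_trans _ _ (\int[vol]_(q in B) (V q)%:E)%E).
    have -> : (v%:E * vol B = \int[vol]_(q in B) (cst v%:E) q)%E by rewrite integral_cst.
    apply: ge0_le_integral => //.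
    - by move=> q _; rewrite lee_fin ltW.
    - exact: (measurable_funTS mV).
    - by move=> q [_ /negP]; rewrite -ltNge lee_fin => /ltW.
  apply: ge0_subset_integral => //.
  - exact: (measurable_funTS mV).
  - by move=> q _; rewrite lee_fin abs_potential_ge0.
  - by move=> q [].
have Bfin : vol B \is a fin_num.
  rewrite ge0_fin_numE// (@le_lt_trans _ _ X%:E) ?ltry//.
  by rewrite -volQ QE leeDl.
have Afin : vol A \is a fin_num.
  rewrite ge0_fin_numE// (@le_lt_trans _ _ X%:E) ?ltry//.
  by rewrite -volQ QE leeDr.
move: markov QE; rewrite volQ -(fineK Bfin) -(fineK Afin) -EFinM -EFinD !lee_fin.
set x := fine _; set y := fine _ => vx [XE].
(* Here 49/60 is the ratio of the mean bound 49/24 to the 5/2 in [v]; the remaining 11/60 exceeds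
   1/8. *)
have : x <= X * (49 / 60).
  rewrite -(ler_pM2l v_gt0); apply: (le_trans vx).
  rewrite (_ : v * (X * (49 / 60)) =
     X * (g * (7 / (3 * a)) * (M%:R ^+ 2 / 2))); last first.
    by rewrite /v /a; field; rewrite gt_eqF.
  rewrite ler_pM2l// ler_wpM2l//.
    by rewrite mulr_ge0 ?(ltW g_gt0)// divr_ge0// mulr_ge0// ltW.
  by rewrite ler_pM2r//; have := M0; nra.
by lra.
Qed.

Lemma abs_potential_dilate (l : R) (q : M.-tuple space) : 0 < l ->
  V (dilate l q) = l^-1 * V q.
Proof.
move=> l0; rewrite /abs_potential mulr_sumr; apply: eq_bigr => i _.
rewrite mulr_sumr; apply: eq_bigr => j _; rewrite !tnth_map.
rewrite (_ : Defs.dist _ _ = l * Defs.dist (tnth q i) (tnth q j)); last first.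
  rewrite /Defs.dist -[in RHS](gtr0_norm l0) -sqrtr_sqr -sqrtrM ?sqr_ge0//.
  congr Num.sqrt; rewrite mulr_sumr; apply: eq_bigr => k _.
  by rewrite !tnth_map -exprMn /mull mulrBr.
by rewrite invfM mulrCA.
Qed.

(* This set is a cone because the potential is homogeneous of degree -1. *)
Definition low_cone (kappa : R) : set (M.-tuple space) :=
  [set q | V q ^+ 2 * normsqN q <= kappa].

Lemma measurable_low_cone kappa : measurable (low_cone kappa).
Proof.
rewrite -[X in measurable X]setTI.
rewrite (_ : low_cone kappa = (fun q => V q ^+ 2 * normsqN q) @^-1` `]-oo, kappa]); last first.
  by apply/seteqP; split => q /=; rewrite in_itv.
have : measurable_fun [set: M.-tuple space] (fun q => V q ^+ 2 * normsqN q).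
  apply: measurable_funM; last exact: measurable_normsqN.
  by apply: measurable_funX; exact: measurable_abs_potential.
by apply => //; exact: measurable_itv.
Qed.

Lemma vol_low_cone_dilate (kappa t theta : R) : 0 < theta ->
  vol (low_cone kappa `&` [set q | normsqN q <= theta * t]) =
  ((Num.sqrt theta ^+ (3 * M))%:E *
    vol (low_cone kappa `&` [set q | (normsqN q <= t)%R]))%E.
Proof.
move=> th0; have st0 : 0 < Num.sqrt theta by rewrite sqrtr_gt0.
rewrite -{1}[Num.sqrt theta]invrK -lebesgue3N_dilate ?invr_gt0//; last first.
  by apply: measurableI; [exact: measurable_low_cone|exact: measurable_normsqN_le].
congr (vol _); apply/seteqP; split => q /=;
  rewrite /low_cone /= normsqN_dilate abs_potential_dilate ?invr_gt0// exprVn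
    sqr_sqrtr ?(ltW th0)// invrK exprMn sqr_sqrtr ?(ltW th0)//
    ler_pdivrMl// mulrACA divff ?gt_eqF// mul1r //.
Qed.

(** A dilation carries the part of the cone in the large ball onto its part in the small one. The
    latter thus has at most half the volume, and the other half lies between the two spheres. *)
Lemma vol_low_cone_shell (kappa t theta : R) : 0 < theta ->
  Num.sqrt theta ^+ (3 * M) <= 1 / 2 ->
  (2^-1%:E * vol (low_cone kappa `&` [set q | (normsqN q <= t)%R]) <=
   vol (low_cone kappa `&` [set q | (theta * t < normsqN q <= t)%R]))%E.
Proof.
move=> th0 th.
set F := low_cone kappa `&` [set q | (normsqN q <= t)%R].
have mF : measurable F.
  by apply: measurableI; [exact: measurable_low_cone|exact: measurable_normsqN_le].
have mL := @measurable_normsqN_le R M (theta * t).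
have Ffin : vol F \is a fin_num.
  rewrite ge0_fin_numE//.
  apply: (@le_lt_trans _ _ (vol [set q | (normsqN q <= t)%R])).
    apply: le_measure; rewrite ?inE => //; last exact: subIsetr.
    exact: measurable_normsqN_le.
  by rewrite vol_ball ?ltry.
have -> : low_cone kappa `&` [set q | (theta * t < normsqN q <= t)%R] =
    F `\` [set q | normsqN q <= theta * t].
  apply/seteqP; split => q /=.
    by move=> [Sq /andP[q1 q2]]; split => //; apply/negP; rewrite -ltNge.
  by move=> [[Sq q2] /negP]; rewrite -ltNge => q1; split => //; rewrite q1 q2.
have FE : vol F = (vol (F `\` [set q | (normsqN q <= theta * t)%R]) +
    vol (F `&` [set q | (normsqN q <= theta * t)%R]))%E by exact: measureDI.
have le2 : (vol (F `&` [set q | (normsqN q <= theta * t)%R]) <= 2^-1%:E * vol F)%E.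
  apply: (@le_trans _ _ ((Num.sqrt theta ^+ (3 * M))%:E * vol F)%E); last first.
    by rewrite lee_wpmul2r// lee_fin -[_^-1]mul1r.
  rewrite -vol_low_cone_dilate//; apply: le_measure; rewrite ?inE.
  - exact: measurableI.
  - by apply: measurableI => //; exact: measurable_low_cone.
  - by move=> q [[]].
have D0 : (0 <= vol (F `\` [set q | (normsqN q <= theta * t)%R]))%E by exact: measure_ge0.
have C0 : (0 <= vol (F `&` [set q | (normsqN q <= theta * t)%R]))%E by exact: measure_ge0.
move: FE le2 D0 C0.
set D := vol (F `\` _); set C := vol (F `&` _) => FE le2 D0 C0.
have Dfin : D \is a fin_num.
  by rewrite ge0_fin_numE// (@le_lt_trans _ _ (vol F))// ?ltey_eq ?Ffin// FE leeDl.
have Cfin : C \is a fin_num.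
  by rewrite ge0_fin_numE// (@le_lt_trans _ _ (vol F))// ?ltey_eq ?Ffin// FE leeDr.
move: FE le2; rewrite -(fineK Dfin) -(fineK Cfin) -(fineK Ffin) -EFinD -!EFinM !lee_fin.
by move=> [] ->; lra.
Qed.

(** This is [1 - 1 / N]: close enough to 1 for the tolerance [eps], yet [theta ^ (3M / 2)] is below
    1/2. *)
Let theta : R := M%:R / M.+1%:R.
Let t : R := M%:R * rho ^+ 2.

Definition typical_shell : set (M.-tuple space) :=
  low_cone (v ^+ 2 * t) `&` [set q | (theta * t < normsqN q <= t)%R].

Lemma vol_typical_shell :
  (((8 * (4 / 7 * rho) ^+ 3) ^+ M / 16)%:E <= vol typical_shell)%E.
Proof.
have th0 : 0 < theta by rewrite divr_gt0.
have S0 : 0 < M.+1%:R :> R by [].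
have th : Num.sqrt theta ^+ (3 * M) <= 1 / 2.
  have thM : theta ^+ M <= 2^-1.
    rewrite (_ : theta = (1 + M%:R^-1)^-1); last first.
      by rewrite /theta -natr1; field; rewrite !gt_eqF// addr_gt0.
    (* Bernoulli's inequality gives [(1 + 1 / M) ^+ M >= 2]. *)
    have bernoulli n (x : R) : 0 <= x -> 1 + n%:R * x <= (1 + x) ^+ n.
      move=> x0; elim: n => [|n ih]; first by rewrite mul0r addr0 expr0.
      have n0 : 0 <= n%:R * x ^+ 2 by rewrite mulr_ge0 ?sqr_ge0.
      rewrite exprS (le_trans (y := (1 + x) * (1 + n%:R * x)))//; last first.
        by rewrite ler_wpM2l// addr_ge0.
      by rewrite -natr1; nra.
    rewrite exprVn lef_pV2 ?posrE ?exprn_gt0 ?addr_gt0 ?invr_gt0//.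
    have := bernoulli M M%:R^-1; rewrite invr_ge0 (ltW M0) => /(_ isT).
    by rewrite divff ?gt_eqF.
  (* After squaring, the claim is [theta ^+ (3 * M) <= 1 / 4], and the left side is at most
     [2^-1 ^+ 3]. *)
  rewrite -ler_sqr ?nnegrE ?exprn_ge0 ?sqrtr_ge0//.
  rewrite exprAC sqr_sqrtr ?(ltW th0)// mulnC exprM.
  apply: (@le_trans _ _ (2^-1 ^+ 3)).
    by rewrite ler_pXn2r ?nnegrE// exprn_ge0// ltW.
  lra.
apply: le_trans (vol_low_cone_shell (v ^+ 2 * t) t th0 th).
apply: (@le_trans _ _ (2^-1%:E * ((8 * a ^+ 3) ^+ M / 8)%:E)%E).
  by rewrite -EFinM lee_fin le_eqVlt -/a; apply/orP; left; apply/eqP; field.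
rewrite lee_wpmul2l//; apply: le_trans vol_low_potential_cube _.
apply: le_measure; rewrite ?inE.
- by apply: measurableI; [exact: measurable_cubeN|exact: measurable_abs_potential_le].
- by apply: measurableI; [exact: measurable_low_cone|exact: measurable_normsqN_le].
move=> q [qa qv].
have qt : normsqN q <= t.
  apply: (le_trans (cubeN_normsqN_le (ltW a_gt0) qa)); rewrite /a /t.
  have : 0 <= M%:R * rho ^+ 2 by rewrite mulr_ge0 ?sqr_ge0.
  rewrite (_ : 3 * M%:R * (4 / 7 * rho) ^+ 2 = 48 / 49 * (M%:R * rho ^+ 2)).
    by clear q qa qv; lra.
  by field.
split => //; rewrite /low_cone/= ler_pM ?sqr_ge0 ?normsqN_ge0//.
by rewrite ler_sqr ?nnegrE ?(ltW v_gt0) ?abs_potential_ge0.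
Qed.

(** In the shell the cone condition gives [V q ^+ 2 * theta <= v ^+ 2], and [theta >= 3 / 4] for
    [M >= 3]. Since 4/3 <= (7/6)^2, the bound is [7 / 6 * v], and 35/12 = 7/6 * 5/2. *)
Lemma typical_shell_potential q : (3 <= M)%N -> typical_shell q ->
  V q <= 35 / 12 * M%:R ^+ 2 * g / rho.
Proof.
move=> M3 [qc /= /andP[q1 q2]].
have S0 : 0 < M.+1%:R :> R by [].
have M3' : 3 <= M%:R :> R by rewrite ler_nat.
have t0 : 0 < t by rewrite mulr_gt0 ?exprn_gt0.
have V0 : 0 <= V q by exact: abs_potential_ge0.
have h : V q ^+ 2 * (theta * t) <= v ^+ 2 * t.
  by apply: le_trans qc; rewrite ler_wpM2l ?sqr_ge0// ltW.
have th34 : 3 / 4 <= theta by rewrite /theta ler_pdivlMr// -natr1; lra.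
have {}h : V q ^+ 2 * (3 / 4) <= v ^+ 2.
  rewrite -(ler_pM2r t0) (le_trans _ h)// -mulrA ler_wpM2l ?sqr_ge0//.
  by rewrite ler_pM2r.
rewrite (_ : 35 / 12 * M%:R ^+ 2 * g / rho = 7 / 6 * v); last by rewrite /v; field; rewrite gt_eqF.
have v70 : 0 <= 7 / 6 * v by rewrite mulr_ge0// ltW.
rewrite -ler_sqr ?nnegrE// exprMn.
by have := sqr_ge0 v; lra.
Qed.

End TypicalShell.

(** * Lower bound on the configuration volume of the macro-region *)

Section MacroRegionLower.
Context {R : realType}.
Local Notation space := (@Defs.space R).
Variables (G m U eps rho : R) (M : nat).
Hypotheses (G_gt0 : 0 < G) (m_gt0 : 0 < m) (M_ge3 : (3 <= M)%N) (rho_gt0 : 0 < rho).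
Hypotheses (U_gt0 : 0 < U) (eps_lt1 : eps < 1) (eps_gt : 2 / M.+1%:R < eps).
Local Notation g := (G * m ^+ 2).
Hypothesis U_large : 4 * M.+1%:R ^+ 2 * g <= U * rho.
Local Notation A := (@macro_region R M.+1 G m (m * (M%:R * rho ^+ 2)) U eps).

Let g_gt0 : 0 < g. Proof. by rewrite mulr_gt0// exprn_gt0. Qed.
Let M_gt0 : (0 < M)%N. Proof. exact: leq_trans M_ge3. Qed.
Let M3 : 3 <= M%:R :> R. Proof. by rewrite ler_nat. Qed.
Let eps_gt0 : 0 < eps. Proof. by apply: lt_trans eps_gt; rewrite divr_gt0. Qed.

Lemma typical_shell_section (q : M.-tuple space) : typical_shell G m rho q ->
  exists c : 'I_3 -> R, forall x, cube c (eps * g / (4 * U)) x -> A (tcons (x, q)).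
Proof.
move=> Tq.
have Vq0 : 0 <= abs_potential G m q by exact: abs_potential_ge0.
have [_ /= /andP[q1 q2]] := Tq.
have Vq := typical_shell_potential G_gt0 m_gt0 M_gt0 rho_gt0 M_ge3 Tq.
have Y0 : 0 <= g / rho by rewrite divr_ge0 ?(ltW rho_gt0)// ltW.
have UY : 4 * M.+1%:R ^+ 2 * (g / rho) <= U by rewrite mulrA ler_pdivrMr.
(* The budget of the potential: [(1 + 35 / 12) * M ^ 2 <= 4 * (M + 1) ^ 2]. *)
have VU : M%:R ^+ 2 * g / rho + abs_potential G m q <= U.
  rewrite (le_trans (lerD (lexx _) Vq))// (le_trans _ UY)// -![_ * g / rho]mulrA.
  by rewrite -mulrDl ler_wpM2r// -natr1; have := M3; nra.
have [x [xrho Wx xfar]] := exists_site M_gt0 g_gt0 rho_gt0 U_gt0 Vq0 q2 VU.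
exists (fun k => tnth x k : R) => y yx.
have b0 : 0 <= eps * g / (4 * U).
  by apply: divr_ge0; apply: mulr_ge0; rewrite // ltW.
have d1 := cube_dist b0 yx.
have b2 : 2 * (eps * g / (4 * U)) = eps * g / (2 * U) by field; rewrite gt_eqF.
rewrite b2 in d1.
have e01 : 0 < eps < 1 by rewrite eps_gt0.
split => /=.
  by rewrite abs_potential_tcons; exact: (site_window g_gt0 U_gt0 Vq0 e01 Wx xfar d1).
rewrite inertiaE normsqN_tcons.
set P := M%:R * rho ^+ 2 in q1 q2 *.
have P0 : 0 < P by rewrite mulr_gt0 ?exprn_gt0// ltr0n.
have S0 : 0 < M.+1%:R :> R by [].
have SE : M.+1%:R = M%:R + 1 :> R by rewrite natr1.
have eM : 2 <= eps * M.+1%:R by rewrite -ler_pdivrMr// ltW.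
(* As [M + 1 >= 4], [U_large] yields [64 * g <= U * rho], so [y] is within [rho / 128] of [x];
   moreover [eps * M >= 2 * M / (M + 1) >= 3 / 2], which exceeds [(129 / 128) ^+ 2]. *)
have yrho : normsq y <= eps * P.
  have dy : Defs.dist y x <= rho / 128.
    apply: (le_trans d1); rewrite ler_pdivrMr ?mulr_gt0//.
    have h1 : eps * g <= g by rewrite ler_piMl ?(ltW g_gt0) ?(ltW eps_lt1).
    have h2 : 64 * g <= U * rho.
      apply: le_trans U_large; rewrite ler_wpM2r ?(ltW g_gt0)//.
      by rewrite SE; have := M3; nra.
    by rewrite (_ : rho / 128 * (2 * U) = U * rho / 64); [lra|field].
  have sx : Num.sqrt (normsq x) <= rho.
    by rewrite -(ger0_norm (ltW rho_gt0)) -sqrtr_sqr ler_wsqrtr.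
  have sy : Num.sqrt (normsq y) <= 129 / 128 * rho.
    by apply: (le_trans (sqrt_normsq_le y x)); lra.
  have ny : normsq y <= (129 / 128 * rho) ^+ 2.
    rewrite -[leLHS]sqr_sqrtr ?normsq_ge0// ler_sqr// nnegrE ?sqrtr_ge0//.
    by rewrite mulr_ge0// ltW.
  apply: (le_trans ny); rewrite exprMn /P mulrA ler_wpM2r ?sqr_ge0//.
  have : M.+1%:R * (129 / 128) ^+ 2 <= M.+1%:R * (eps * M%:R) :> R.
    rewrite [leRHS](_ : _ = eps * M.+1%:R * M%:R); last by ring.
    apply: (@le_trans _ _ (2 * M%:R)).
      by rewrite SE; have := M3; lra.
    by rewrite ler_wpM2r.
  by rewrite ler_pM2l.
have y0 := normsq_ge0 y.
rewrite !(mulrCA _ m) !ler_pM2l//; apply/andP; split.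
  (* From below the shell alone suffices, since [eps >= 1 / (M + 1)]; from above the added particle
     costs at most [eps * P] by [yrho]. *)
  have h : (1 - eps) * P <= M%:R / M.+1%:R * P.
    rewrite ler_pM2r// ler_pdivlMr// mulrBl mul1r.
    by rewrite SE in eM *; lra.
  by apply: (le_trans h); apply: (le_trans (ltW q1)); rewrite lerDr.
by rewrite mulrDl mul1r addrC lerD.
Qed.

(** Tonelli with the added particle as head of the tuple: over each point of the typical shell the
    fibre contains a cube of side [eps * g / (2 * U)]. Its centre may depend on [q] non-measurably;
    only the inner integral, bounded below by a constant, is compared. *)
Lemma vol_macro_region_ge :
  (((8 * (4 / 7 * rho) ^+ 3) ^+ M / 16 * (eps * g / (2 * U)) ^+ 3)%:E
    <= lebesgue3N M.+1 A)%E.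
Proof.
have mA : measurable A by exact: measurable_macro_region.
have mT : measurable (@typical_shell R G m M rho).
  apply: measurableI; first exact: measurable_low_cone.
  rewrite (_ : [set q | _] = [set q | normsqN q <= M%:R * rho ^+ 2] `\`
    [set q | normsqN q <= M%:R / M.+1%:R * (M%:R * rho ^+ 2)]).
    by apply: measurableD; exact: measurable_normsqN_le.
  apply/seteqP; split => q /=.
    by move=> /andP[h1 h2]; split => //; apply/negP; rewrite -ltNge.
  by move=> [h2 /negP]; rewrite -ltNge => h1; rewrite h1 h2.
have c0 : 0 <= eps * g / (2 * U).
  by apply: divr_ge0; apply: mulr_ge0; rewrite // ltW.
have mI : measurable_fun [set: M.+1.-tuple space] (fun q => (\1_A q : R)%:E).
  by apply/measurable_EFinP; exact: measurable_indic.
have I0 (q : M.+1.-tuple space) : (0 <= (\1_A q : R)%:E)%E by rewrite lee_fin indicE.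
rewrite -[X in (_ <= lebesgue3N _ X)%E]setIT -integral_indic//.
rewrite integral_tupleSr//.
apply: (@le_trans _ _ (\int[lebesgue3N M]_(q in typical_shell G m rho)
   ((eps * g / (2 * U)) ^+ 3)%:E)%E).
  rewrite (_ : (\int[_]_(q in _) _)%E = (((eps * g / (2 * U)) ^+ 3)%:E *
     lebesgue3N M (typical_shell G m rho))%E); last exact: integral_cst.
  rewrite EFinM muleC lee_wpmul2l ?lee_fin ?exprn_ge0//.
  exact: vol_typical_shell.
rewrite integral_mkcond; apply: ge0_le_integral => //.
- by move=> q _; rewrite patchE; case: ifP => // _; rewrite lee_fin exprn_ge0.
- by apply/(measurable_restrictT _ mT); exact: measurable_cst.
- exact: (measurable_integral_tconsr (@lebesgue3 R) mI I0).
move=> q _; rewrite patchE; case: ifPn => qT; last exact: integral_ge0.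
have /typical_shell_section[c hc] : typical_shell G m rho q by rewrite inE in qT.
have b0 : 0 <= eps * g / (4 * U).
  by apply: divr_ge0; apply: mulr_ge0; rewrite // ltW.
apply: (@le_trans _ _ (\int[@lebesgue3 R]_x (\1_(cube c (eps * g / (4 * U))) x)%:E)%E).
  rewrite integral_indic//; last exact: measurable_cube.
  rewrite setIT le_eqVlt; apply/orP; left; apply/eqP/esym.
  apply: etrans (lebesgue3_cube c b0) _; congr (_ ^+ 3)%:E.
  by field; rewrite gt_eqF.
apply: ge0_le_integral => //.
- by apply/measurable_EFinP; apply: measurable_indic; exact: measurable_cube.
- exact: (measurableT_comp mI (measurableT_comp (@measurable_tcons _ _ M)
    (measurable_fun_pair (@measurable_id _ _ setT) (measurable_cst q)))).
- move=> x _; rewrite lee_fin !indicE ler_nat; case: (boolP (x \in cube _ _)) => //=.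
  by rewrite inE => /hc xA; rewrite mem_set.
Qed.

End MacroRegionLower.

(** * Numerical estimates *)

Section Numerics.
Context {R : realType}.

Lemma expR2_ge : 13 / 2 <= expR 2 :> R.
Proof.
have h : 9 / 8 <= expR (1 / 8) :> R by apply: le_trans (expR_ge1Dx _); lra.
rewrite (_ : 2 = 1 / 8 * 16%:R); last by field.
rewrite expRM_natr; apply: (@le_trans _ _ ((9 / 8) ^+ 16)); first by lra.
by rewrite ler_pXn2r ?nnegrE ?expR_ge0.
Qed.

Lemma expR1_le4 : expR 1 <= 4 :> R.
Proof.
have h : 1 / 2 <= expR (- (1 / 2)) :> R by apply: le_trans (expR_ge1Dx _); lra.
have e1 : expR 1 * expR (- (1 / 2)) ^+ 2 = 1 :> R.
  by rewrite -expRM_natr -expRD (_ : 1 + _ = 0) ?expR0//; field.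
have h2 : 1 / 4 <= expR (- (1 / 2)) ^+ 2 :> R by nra.
have := ler_wpM2l (expR_ge0 (1 : R)) h2; rewrite e1; lra.
Qed.

(** All numerical constants of the lower bound meet here: 512/343 is [8 * (4 / 7) ^+ 3] from the
    cube of typical configurations, and 128 is the 16 of [vol_typical_shell] times the [2 ^ 3] from
    the cube of side [eps * g / (2 * U)]. *)
Lemma sphere_area_bound (M : nat) : (3 <= M)%N ->
  @sphere_area R M.+1 * expR (- (9 / 2) * M.+1%:R) * Num.sqrt M%:R ^+ (3 * M) <=
  (512 / 343) ^+ M / 128.
Proof.
move=> M3; set N := M.+1.
have N_gt0 : (0 < N)%N by [].
have N0 : 0 < N%:R :> R by rewrite ltr0n.
have w0 : 0 < Num.sqrt N%:R :> R by rewrite sqrtr_gt0.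
have w1 : 1 <= Num.sqrt N%:R :> R by rewrite -[leLHS]sqrtr1 ler_wsqrtr// ler1n.
pose y : R := Num.sqrt (16 / 39).
have y0 : 0 <= y by exact: sqrtr_ge0.
have y3 : y ^+ 3 <= 4 / 15.
  rewrite -ler_sqr ?nnegrE ?exprn_ge0//.
  by rewrite exprAC sqr_sqrtr//; lra.
(* [z] is the bound per coordinate, with e^(-3/2) as its share of e^(-9N/2). Its square is
   [2 * pi * e^(-2) / (3 * N)], at most [16 / 39 / N] because [pi <= 4] and [e^2 >= 13 / 2]. *)
pose z : R := Num.sqrt (pi * expR 1 / (3 * N%:R / 2)) * expR (- (3 / 2)).
have z0 : 0 <= z by rewrite mulr_ge0 ?sqrtr_ge0 ?expR_ge0.
have zy : z <= y / Num.sqrt N%:R.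
  rewrite -ler_sqr ?nnegrE ?divr_ge0 ?sqrtr_ge0//.
  rewrite exprMn expr_div_n !sqr_sqrtr//; last first.
    by rewrite divr_ge0 ?mulr_ge0 ?pi_ge0 ?expR_ge0.
  rewrite -expRM_natr (_ : - (3 / 2) * 2%:R = - 3); last by field.
  have pe : pi * (expR 1 * expR (- 3)) <= 8 / 13 :> R.
    rewrite -expRD (_ : 1 - 3 = - 2); last by ring.
    rewrite expRN ler_pdivrMr ?expR_gt0//.
    have : pi <= 4 :> R by have := @pihalf_lt2 R; lra.
    by have := expR2_ge; lra.
  rewrite (_ : pi * expR 1 / (3 * N%:R / 2) * expR (- 3) =
    pi * (expR 1 * expR (- 3)) * (2 / 3 / N%:R)); last by field; rewrite gt_eqF.
  rewrite (_ : 16 / 39 / N%:R = 8 / 13 * (2 / 3 / N%:R)); last by field; rewrite gt_eqF.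
  by rewrite ler_wpM2r// !divr_ge0.
have area : @sphere_area R N * expR (- (9 / 2) * N%:R) <= 3 * N%:R * z ^+ (3 * N).
  rewrite (_ : - (9 / 2) * N%:R = - (3 / 2) * (3 * N)%:R); last by rewrite natrM; field.
  rewrite expRM_natr unit_ball_volume_sphere_area// /z exprMn mulrA.
  rewrite ler_wpM2r ?exprn_ge0 ?expR_ge0// ler_wpM2l ?mulr_ge0//.
  rewrite sqrt_expr3N; first exact: unit_ball_volume_le.
  by rewrite divr_ge0 ?mulr_ge0 ?pi_ge0 ?expR_ge0.
have sM : Num.sqrt M%:R ^+ (3 * M) <= Num.sqrt N%:R ^+ (3 * M) :> R.
  apply: lerXn2r; rewrite ?nnegrE ?sqrtr_ge0//.
  by rewrite ler_wsqrtr// ler_nat.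
apply: (@le_trans _ _ (3 * N%:R * (y / Num.sqrt N%:R) ^+ (3 * N) *
    Num.sqrt N%:R ^+ (3 * M))).
  apply: ler_pM => //.
  - rewrite mulr_ge0 ?expR_ge0// unit_ball_volume_sphere_area//.
    by rewrite !mulr_ge0// ltW// unit_ball_volume_gt0.
  - apply: (le_trans area); rewrite ler_wpM2l ?mulr_ge0//.
    by apply: lerXn2r => //; rewrite nnegrE divr_ge0 ?sqrtr_ge0.
apply: (@le_trans _ _ (3 * (y ^+ 3) ^+ N)).
  rewrite -exprM expr_div_n {2}/N mulnSr [X in _ / X]exprD -{1}(sqr_sqrtr (ltW N0)).
  set w := Num.sqrt N%:R in w0 w1 *; set W := w ^+ (3 * M); set Y := y ^+ _.
  have W0 : 0 < W by rewrite exprn_gt0.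
  have Y0 : 0 <= Y by rewrite exprn_ge0.
  rewrite (_ : _ * W = 3 * Y / w); last by field; rewrite !gt_eqF.
  by rewrite ler_pdivrMr// ler_peMr// mulr_ge0.
apply: (@le_trans _ _ (3 * (4 / 15) ^+ N)).
  by rewrite ler_pM2l//; apply: lerXn2r; rewrite ?nnegrE ?exprn_ge0.
(* 384 = 3 * 128, and 7680/1372 is the quotient of 512/343 by 4/15. The fourth power already
   suffices, and [N >= 4]. *)
have key : 384 * (512 / 343) <= (7680 / 1372) ^+ N :> R.
  apply: (@le_trans _ _ ((7680 / 1372) ^+ 4)); first by lra.
  by rewrite ler_weXn2l//; lra.
have : (512 / 343) * (512 / 343) ^+ M = (7680 / 1372) ^+ N * (4 / 15) ^+ N :> R.
  by rewrite -exprS -exprMn; congr (_ ^+ _); field.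
have q0 : 0 <= (4 / 15) ^+ N :> R by rewrite exprn_ge0.
have := ler_wpM2r q0 key.
set q := (4 / 15) ^+ N; set P := _ ^+ N; set B := _ ^+ M.
by move=> h1 h2; lra.
Qed.

End Numerics.

Section HalfIntegerPowers.
Context {R : realType}.

Lemma powR_five_halves (x : R) : 0 < x -> x `^ (5 / 2) = x ^+ 2 * Num.sqrt x.
Proof.
move=> x0; rewrite (_ : 5 / 2 = 2%:R + 2^-1); last by field.
rewrite powRD; last by rewrite gt_eqF ?implybT.
by rewrite powR_mulrn ?ltW// powR12_sqrt// ltW.
Qed.

End HalfIntegerPowers.

Theorem mainTheorem1 (R : realType) (N : nat) (G m h E I U eps : R)
    (N_ge4 : (4 <= N)%N) (G_gt0 : 0 < G) (m_gt0 : 0 < m) (h_gt0 : 0 < h)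
    (I_gt0 : 0 < I) (U_gt0 : 0 < U) (eps_lt1 : eps < 1)
    (eps_gt : 2 / N%:R < eps) :
  let C := prefactor N m h in
  let n := (3 * N%:R - 2) / 2 in
  (4 * G * m `^ (5 / 2) * ln N%:R * N%:R `^ (5 / 2) <= Num.sqrt I * U ->
    [/\ cvg (shell_volume N G m h E I U eps eta @[eta --> 0^'+]),
        ((C * expR (- (9 / 2) * N%:R) * (G * m ^+ 2 * eps / U) ^+ 3
            * pos_powR (E + (1 - eps) * U) n
            * (I / m) `^ ((3 * N%:R - 3) / 2))%:E
          <= phase_volume N G m h E I U eps)%E
      & (phase_volume N G m h E I U eps
          <= (C * pos_powR (E + (1 + eps) * U) n
                * ((1 + eps) * (I / m)) `^ (3 * N%:R / 2))%:E)%E])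
  /\ (0 <= E ->
       ((E + (1 + eps) * U) `^ n <= (1 + eps) `^ n * (E + U) `^ n
        /\ (1 + eps) `^ n * (E + U) `^ n <= expR (eps * n) * (E + U) `^ n)
       /\ (eps < 1 / 2 ->
            (1 - eps) `^ n * (E + U) `^ n <= (E + (1 - eps) * U) `^ n
            /\ expR (- 2 * eps * n) * (E + U) `^ n
                 <= (1 - eps) `^ n * (E + U) `^ n)).
Proof.
move=> C n.
have N0 : 0 < N%:R :> R by rewrite ltr0n (leq_trans _ N_ge4).
have N4 : 4 <= N%:R :> R by rewrite ler_nat.
have eps_gt0 : 0 < eps by apply: lt_trans eps_gt; rewrite divr_gt0.
have n0 : 0 <= n by rewrite /n; lra.
split; last first.
  move=> E0; have EU0 : 0 <= E + U by rewrite addr_ge0// ltW.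
  have eE : 0 <= eps * E by rewrite mulr_ge0// ltW.
  have eU : 0 <= eps * U by rewrite mulr_ge0// ltW.
  have e1 : 0 <= 1 - eps by lra.
  split; [split|move=> e2; split].
  - rewrite -powRM//; last by lra.
    by apply: ge0_ler_powR; rewrite ?nnegrE//; nra.
  - rewrite ler_wpM2r ?powR_ge0// expRM.
    apply: ge0_ler_powR; rewrite ?nnegrE ?expR_ge0//; first by lra.
    exact: expR_ge1Dx.
  - rewrite -powRM//.
    by apply: ge0_ler_powR; rewrite ?nnegrE ?mulr_ge0//; nra.
  - rewrite ler_wpM2r ?powR_ge0// expRM.
    apply: ge0_ler_powR; rewrite ?nnegrE ?expR_ge0//.
    have e2' : 1 + 2 * eps <= expR (2 * eps) by exact: expR_ge1Dx.
    rewrite mulNr expRN -[leLHS]mul1r ler_pdivrMr ?expR_gt0//.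
    (* [(1 - eps) * (1 + 2 * eps) = 1 + eps * (1 - 2 * eps)], which is at least 1 for
       [eps < 1 / 2]. *)
    apply: (@le_trans _ _ ((1 - eps) * (1 + 2 * eps))); first by nra.
    by rewrite ler_wpM2l.
case: N N_ge4 @C @n eps_gt N0 N4 n0 => // M M4 C n eps_gt N0 N4 n0 hyp.
have M3 : (3 <= M)%N by exact: M4.
have M_gt0 : (0 < M)%N by exact: leq_trans M3.
have M0 : 0 < M%:R :> R by rewrite ltr0n.
have nE : n = 3 * M.+1%:R / 2 - 1 by rewrite /n; field.
(* Chosen so that [I = m * M * rho ^+ 2]: the first [M] particles alone carry the prescribed moment
   of inertia. *)
pose rho := Num.sqrt (I / m / M%:R).
have J0 : 0 < I / m by rewrite divr_gt0.
have rho_gt0 : 0 < rho by rewrite sqrtr_gt0 divr_gt0.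
have JE : I / m = M%:R * rho ^+ 2.
  rewrite /rho sqr_sqrtr; first by field; rewrite !gt_eqF.
  by rewrite divr_ge0// ltW.
have IE : I = m * (M%:R * rho ^+ 2) by rewrite -JE mulrC divfK// gt_eqF.
set g := G * m ^+ 2.
have g_gt0 : 0 < g by rewrite mulr_gt0// exprn_gt0.
have U_large : 4 * M.+1%:R ^+ 2 * g <= U * rho.
  move: hyp; rewrite !powR_five_halves// {1}IE.
  (* [N >= 4 >= e]. The powers 5/2 then split into a square, kept in [U_large], and a square root:
     that of [m] cancels, that of [N] absorbs the [Num.sqrt M] contained in [Num.sqrt I]. *)
  have ln1 : 1 <= ln M.+1%:R :> R.
    rewrite -[leLHS]expRK ler_ln ?posrE ?expR_gt0//.
    exact: le_trans expR1_le4 N4.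
  have sm : 0 < Num.sqrt m by rewrite sqrtr_gt0.
  have sN : 0 < Num.sqrt M.+1%:R :> R by rewrite sqrtr_gt0.
  have -> : Num.sqrt (m * (M%:R * rho ^+ 2)) = Num.sqrt m * (Num.sqrt M%:R * rho).
    by rewrite sqrtrM ?(ltW m_gt0)// sqrtrM ?(ltW M0)// sqrtr_sqr gtr0_norm.
  have sMN : Num.sqrt M%:R <= Num.sqrt M.+1%:R :> R by rewrite ler_wsqrtr// ler_nat.
  rewrite (_ : 4 * G * (m ^+ 2 * Num.sqrt m) * ln M.+1%:R *
      (M.+1%:R ^+ 2 * Num.sqrt M.+1%:R) =
    Num.sqrt m * (Num.sqrt M.+1%:R * (4 * M.+1%:R ^+ 2 * g * ln M.+1%:R))); last first.
    by rewrite /g; ring.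
  rewrite -[X in _ <= X -> _]mulrA ler_pM2l// => hyp.
  have : Num.sqrt M.+1%:R * (4 * M.+1%:R ^+ 2 * g * ln M.+1%:R) <=
      Num.sqrt M.+1%:R * (U * rho).
    apply: (le_trans hyp).
    by rewrite -mulrA [rho * U]mulrC ler_wpM2r// mulr_ge0// ltW.
  rewrite ler_pM2l// => /(le_trans _); apply; apply: ler_peMr => //.
  by apply: mulr_ge0 (ltW g_gt0); rewrite mulr_ge0// exprn_ge0.
clearbody rho.
have N1 : (1 < M.+1)%N by rewrite ltnS.
pose v := expR (- (9 / 2) * M.+1%:R) * (g * eps / U) ^+ 3
  * (I / m) `^ ((3 * M.+1%:R - 3) / 2).
have v0 : 0 <= v.
  rewrite mulr_ge0 ?powR_ge0// mulr_ge0 ?expR_ge0// exprn_ge0//.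
  by rewrite divr_ge0 ?(ltW U_gt0)// mulr_ge0// ltW.
have vA : ((sphere_area M.+1 * v)%:E <=
    lebesgue3N M.+1 (macro_region G m I U eps))%E.
  rewrite /v JE {}IE; apply: le_trans
    (vol_macro_region_ge G_gt0 m_gt0 M3 rho_gt0 U_gt0 eps_lt1 eps_gt U_large).
  rewrite lee_fin (_ : (3 * M.+1%:R - 3) / 2 = 3 * M%:R / 2); last first.
    by rewrite -natr1; field.
  rewrite -sqrt_expr3N; last by rewrite mulr_ge0// sqr_ge0.
  rewrite sqrtrM// sqrtr_sqr gtr0_norm// [(Num.sqrt _ * rho) ^+ _]exprMn.
  rewrite (_ : 8 * (4 / 7 * rho) ^+ 3 = 512 / 343 * rho ^+ 3); last by field.
  rewrite [(_ * rho ^+ 3) ^+ M]exprMn -exprM -/g.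
  have Z0 : 0 <= rho ^+ (3 * M) * (g * eps / U) ^+ 3.
    rewrite mulr_ge0 ?exprn_ge0 ?(ltW rho_gt0)//.
    by rewrite divr_ge0 ?(ltW U_gt0)// mulr_ge0// ltW.
  have := ler_wpM2r Z0 (sphere_area_bound M3).
  set S := sphere_area _; set e := expR _; set W := Num.sqrt _ ^+ _.
  set r := rho ^+ _; set B := (512 / 343) ^+ M.
  rewrite (_ : S * e * W * _ = S * (e * (g * eps / U) ^+ 3 * (W * r))); last by ring.
  rewrite (_ : B / 128 * _ = B * r / 16 * (eps * g / (2 * U)) ^+ 3) //.
  by field; rewrite gt_eqF.
rewrite nE; split.
- by apply/cvg_ex; eexists; exact: cvg_shell_volume.
- have regroup (a b c d e : R) : a * b * c * d * e = a * d * (b * c * e) by ring.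
  by rewrite regroup; exact: phase_volume_ge.
- exact: phase_volume_le.
Qed.
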